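(* For every integer $t\geq1$ there exists an integer $s=s(t)\geq1$ with the following property. Let $G$ be a (theta, prism)-free graph with no clique of cardinality $t$ and let $a\in V(G)$. Assume that there is an $a$-seed in $G$. Then for every vertex $x\in V(G)\setminus N_G[a]$ there exists $S_x\subseteq V(G)\setminus\{a,x\}$ with $|S_x|<s$ such that $S_x$ separates $a$ and $x$ in $G$.
   Context: Graphs finite simple. A set $M\subseteq V(G)\setminus\{x,y\}$ separates $x$ and $y$ in $G$ if there is a partition $(L,M,R)$ of $V(G)$ with $x\in L$, $y\in R$ and no edges between $L$ and $R$. Theta: two non-adjacent vertices joined by three internally disjoint induced paths of length $\ge2$ with pairwise anticomplete interiors. Prism: two disjoint triangles $\{a_1,a_2,a_3\},\{b_1,b_2,b_3\}$, disjoint induced paths $P_i$ from $a_i$ to $b_i$, with $a_ia_j,b_ib_j$ the only edges between $P_i,P_j$. (Theta, prism)-free: no induced subgraph is a theta or prism. A caterpillar is a tree of maximum degree three containing a path that contains all vertices of degree more than two. The $1$-subdivision of a graph is obtained by subdividing each edge once. The line graph $L(F)$ has vertex set $E(F)$, two vertices adjacent iff the edges share an end. A vertex is simplicial in $H$ if its neighborhood is a clique; $\mathcal{Z}(H)$ is the set of simplicial vertices of $H$. A vertex $a$ is trapped in an induced subgraph $H'$ of $G$ if every vertex at distance at most two from $a$ in $G$ lies in $H'$ and every neighbor of $a$ has degree two in $H'$. An induced subgraph $H$ of $G\setminus\{a\}$ is an $a$-seed in $G$ if $H$ is (isomorphic to) the line graph of a $1$-subdivision of some caterpillar, $N_G(a)=\mathcal{Z}(H)$,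 and $a$ is trapped in $G[V(H)\cup\{a\}]$. *)

(* Defs.v *)
From mathcomp Require Import all_boot.
Set Implicit Arguments.
Unset Strict Implicit.
Unset Printing Implicit Defensive.

Record sgraph := SGraph {
  vertex :> finType;
  adj : rel vertex;
  adj_sym : symmetric adj;
  adj_irrefl : irreflexive adj
}.
Arguments adj {s} x y.

Definition isomorphic (G H : sgraph) : Prop :=
  exists f : G -> H, bijective f /\ forall x y, adj (f x) (f y) = adj x y.

Section Induced.
Variables (G : sgraph) (S : {set G}).
Definition induced_adj : rel {x : G | x \in S} := fun x y => adj (val x) (val y).
Fact induced_adj_sym : symmetric induced_adj.
Proof. by move=> x y; rewrite /induced_adj adj_sym. Qed.
Fact induced_adj_irrefl : irreflexive induced_adj.
Proof. by move=> x; rewrite /induced_adj adj_irrefl. Qed.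
Definition induced : sgraph := SGraph induced_adj_sym induced_adj_irrefl.
End Induced.

Section Basics.
Variable G : sgraph.
Implicit Types (x y : G) (p : seq G) (K L M R : {set G}).

Definition nbhd x : {set G} := [set y | adj x y].
Definition closed_nbhd x : {set G} := x |: nbhd x.
Definition degree x : nat := #|nbhd x|.
Definition max_degree : nat := \max_(x : G) degree x.

Definition clique K : bool :=
  [forall x in K, forall y in K, (x != y) ==> adj x y].

Definition simplicial : {set G} := [set x | clique (nbhd x)].

Definition dist_le (k : nat) x y : Prop :=
  exists p, [/\ path adj x p, last x p = y & size p <= k].

(* As in [path.v], the path with vertex sequence x :: p is passed as x and p;
   its length (number of edges) is size p. *)
Definition is_path x y p : Prop :=
  [/\ path adj x p, last x p = y & uniq (x :: p)].

Definition is_induced_path x y p : Prop :=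
  is_path x y p /\
  forall i j, i < j <= size p ->
    adj (nth x (x :: p) i) (nth x (x :: p) j) -> j = i.+1.

Definition interior x y p : {set G} := [set z in x :: p] :\: [set x; y].

Definition anticomplete K L : Prop :=
  forall x y, x \in K -> y \in L -> ~~ adj x y.

(* The parts may be empty, hence no use of [finset.partition]. *)
Definition separates M x y : Prop :=
  M \subset ~: [set x; y] /\
  exists L R : {set G},
    [/\ [/\ L :|: M :|: R = [set: G], [disjoint L & M],
            [disjoint L & R] & [disjoint M & R]],
        x \in L, y \in R & anticomplete L R].

Definition connected_graph : Prop :=
  (exists x : G, True) /\ forall x y, connect adj x y.

Definition acyclic : Prop :=
  forall c : seq G, ucycle adj c -> size c < 3.

Definition is_tree : Prop := connected_graph /\ acyclic.

Definition is_caterpillar : Prop :=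
  [/\ is_tree, max_degree = 3 &
      exists x y p, is_path x y p /\ forall z : G, 2 < degree z -> z \in x :: p].

Definition is_theta : Prop :=
  exists (a b : G) (P : 'I_3 -> seq G),
    [/\ a != b /\ ~~ adj a b,
        forall i, is_induced_path a b (P i) /\ 2 <= size (P i),
        forall i j, i != j ->
          [disjoint interior a b (P i) & interior a b (P j)] /\
          anticomplete (interior a b (P i)) (interior a b (P j)) &
        forall z : G, exists i, z \in a :: P i].

Definition is_prism : Prop :=
  exists (a b : 'I_3 -> G) (P : 'I_3 -> seq G),
    [/\ (forall i j, i != j -> adj (a i) (a j) /\ adj (b i) (b j)) /\
        (forall i j, a i != b j),
        forall i, is_induced_path (a i) (b i) (P i),
        forall i j, i != j -> [disjoint a i :: P i & a j :: P j],
        forall i j x y, i != j -> x \in a i :: P i -> y \in a j :: P j ->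
          adj x y -> (x = a i /\ y = a j) \/ (x = b i /\ y = b j) &
        forall z : G, exists i, z \in a i :: P i].

End Basics.

Arguments max_degree G : clear implicits.
Arguments simplicial G : clear implicits.

Definition theta_prism_free (G : sgraph) : Prop :=
  forall U : {set G}, ~ is_theta (induced U) /\ ~ is_prism (induced U).

Definition edges (G : sgraph) : {set {set G}} :=
  [set [set p.1; p.2] | p in [pred p : G * G | adj p.1 p.2]].

Definition edge (G : sgraph) : finType := {A : {set G} | A \in edges G}.

Section LineGraph.
Variable G : sgraph.
Definition line_adj : rel (edge G) :=
  fun A B => (A != B) && (val A :&: val B != set0).
Fact line_adj_sym : symmetric line_adj.
Proof. by move=> A B; rewrite /line_adj eq_sym setIC. Qed.
Fact line_adj_irrefl : irreflexive line_adj.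
Proof. by move=> A; rewrite /line_adj eqxx. Qed.
Definition line_graph : sgraph := SGraph line_adj_sym line_adj_irrefl.
End LineGraph.

Section Subdivision.
Variable G : sgraph.
Definition subdiv_adj : rel (G + edge G)%type := fun u v =>
  match u, v with
  | inl x, inr A => x \in val A
  | inr A, inl x => x \in val A
  | _, _ => false
  end.
Fact subdiv_adj_sym : symmetric subdiv_adj.
Proof. by case=> [x|A] [y|B]. Qed.
Fact subdiv_adj_irrefl : irreflexive subdiv_adj.
Proof. by case. Qed.
Definition subdiv1 : sgraph := SGraph subdiv_adj_sym subdiv_adj_irrefl.
End Subdivision.

Section Seed.
Variable G : sgraph.

Definition trapped (a : G) (U : {set G}) : Prop :=
  (forall y : G, dist_le 2 a y -> y \in U) /\
  (forall y : induced U, adj a (val y) -> degree y = 2).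

(* The induced subgraph G[S] is identified with its vertex set S. *)
Definition is_seed (a : G) (S : {set G}) : Prop :=
  [/\ a \notin S,
      exists C : sgraph,
        is_caterpillar C /\ isomorphic (induced S) (line_graph (subdiv1 C)),
      nbhd a = [set val z | z in simplicial (induced S)] &
      trapped a (a |: S)].

End Seed.

(* Main.v *)
(* A neighbour of [a] has only one neighbour other than [a], so an induced subdivided claw
   of G - a whose leaves are neighbours of [a] yields a theta. At a vertex of degree three
   of the caterpillar the seed splits into three parts meeting in a triangle. Enlarge them
   to a maximal system of disjoint parts A_i with interfaces K_i, such that the edges
   between A_i and A_j are exactly those of K_i x K_j. By maximality a vertex outside the
   parts sees only interfaces, unless it is a jewel, which sees the inside of exactly two
   parts. Excluding thetas and prisms makes the jewels of each of the three kinds a clique,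
   and all but one of the K_i have bounded size, since a stable triple in K_i and two
   nonadjacent vertices of K_j form a theta. So if [x] sees at most one vertex of the
   triangle, a bounded set separates [x] from the neighbours of [a] outside one part.
   If [x] sees two vertices of each of three triangles, there is a theta with ends [x] and
   [a]. Hence following the parts that contain [x] through the tree, a bounded number of
   these sets separate [x] from all neighbours of [a]. *)

Require Import Defs.
From mathcomp Require Import all_boot zify.
From Stdlib Require Import Classical.
Set Implicit Arguments.
Unset Strict Implicit.
Unset Printing Implicit Defensive.

(** * Induced paths *)

(** The tripods grown at different branch vertices are unrelated, so nothing about their parts is
    carried along the tree. What survives is the conclusion of [local_cut]: a small set confines the
    neighbours of [a] still reachable from [x] to one part of the original seed, hence to the leaves
    of one arm of the caterpillar. Such statements combine by unions. A theta or prism is never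
    given by its paths: connected sets with prescribed edges between them suffice, since shortest
    paths inside them are induced. The property [pendant] keeps induced paths of a core away from
    the neighbours of [a] except at their ends, so [a] can close a branch without unwanted edges.
    Constants: jewels cost [3 * t], two interfaces [t * t] each by a Ramsey argument, and [M]
    exceeds the sum by one. An arm with [n] branch vertices whose triangle has two vertices seen by
    [x] costs [M * n.+1] with [n <= 2], and three arms give [9 * M]. *)

Section Linkage.
Variable G : sgraph.
Implicit Types (u v x y z : G) (U V : {set G}) (f : nat -> G).

Definition link_rel U : rel G := [rel u v | [&& u \in U, v \in U & adj u v]].
Definition linked U x y : bool := connect (link_rel U) x y.

Lemma link_relE U u v : link_rel U u v = [&& u \in U, v \in U & adj u v].
Proof. by []. Qed.

Lemma linked_refl U x : linked U x x.
Proof. exact: connect0. Qed.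

Lemma linked_sym U x y : linked U x y = linked U y x.
Proof.
by apply: sym_connect_sym => u v; rewrite !link_relE adj_sym andbCA.
Qed.

Lemma linked_trans U y x z : linked U x y -> linked U y z -> linked U x z.
Proof. exact: connect_trans. Qed.

Lemma linked1 U x y : x \in U -> y \in U -> adj x y -> linked U x y.
Proof. by move=> xU yU xy; apply: connect1; rewrite link_relE xU yU. Qed.

Lemma linkedS U V x y : U \subset V -> linked U x y -> linked V x y.
Proof.
move=> /subsetP UV; apply: connect_sub => u v /= /and3P[uU vU uv].
by apply: connect1; rewrite link_relE !UV.
Qed.

Lemma linked_step U x y : linked U x y -> x != y ->
  exists z, [/\ x \in U, z \in U, adj x z & linked U z y].
Proof.
case/connectP=> [[|z p] /= xp ->]; first by rewrite eqxx.
case/andP: xp => /and3P[xU zU xz] zp _.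
by exists z; split=> //; apply/connectP; exists p.
Qed.

Lemma linked_mem U x y : linked U x y -> x \in U -> y \in U.
Proof.
move=> xy xU; have [<-//|nxy] := eqVneq x y.
by move: xy; rewrite linked_sym eq_sym in nxy * => /linked_step[]// z [].
Qed.

Lemma linked_inv U V x y : linked U x y ->
  (forall u v, u \in V -> u \in U -> v \in U -> adj u v -> v \in V) ->
  x \in V -> y \in V.
Proof.
case/connectP=> p xp -> VP; elim: p x xp => //= v p IH x /andP[/and3P[xU vU xv] vp] xV.
by apply: IH => //; apply: VP xV xU vU xv.
Qed.

(** An induced path as a function on indices, so that segments and concatenations become arithmetic;
    the values of [f] beyond [l] are irrelevant. *)
Definition ipath f l := forall i j, i <= l -> j <= l ->
  (f i == f j) = (i == j) /\ adj (f i) (f j) = (j == i.+1) || (i == j.+1).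

Lemma linked_shortest U x y : linked U x y -> exists p,
  is_induced_path x y p /\ all (mem U) p.
Proof.
move=> xy.
pose P n := exists p, [/\ path (link_rel U) x p, last x p = y, uniq (x :: p) & size p = n].
have [n Pn] : exists n, P n.
  case/connectP: xy => p xp; case/shortenP: xp => q xq uq _ qy.
  by exists (size q), q.
elim/ltn_ind: n Pn => n IH [p [xp px up pn]].
have [[m mn Pm]|noshort] := classic (exists2 m, m < n & P m); first exact: (IH m).
have xpa : path adj x p by apply: sub_path xp => u v /and3P[].
have xpU : all (mem U) p.
  by elim: (p) (x) xp => //= v s IHs z /andP[/and3P[_ -> _]] /IHs.
exists p; split=> //; split=> //.
move=> i j /andP[ij jp] ijadj; apply/eqP; rewrite eqn_leq ij andbT leqNgt.
apply/negP=> lt; case: noshort.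
have ip : i < size p by lia.
have jj : j = j.-1.+1 by lia.
(* Shortcut along the chord. As [p] omits the first vertex [x], position [j] of [x :: p] is position
   [j.-1] of [p]. *)
pose q := take i p ++ drop j.-1 p.
have lasttake k : k <= size p -> last x (take k p) = nth x (x :: p) k.
  move=> kp; rewrite -nth_last size_takel //.
  by case: k kp => [|k] kp; [rewrite take0 | rewrite nth_take].
have dropj : drop j.-1 p = nth x (x :: p) j :: drop j p.
  by rewrite jj /= -drop_nth //; lia.
exists (size q); first by rewrite size_cat size_takel ?size_drop -?pn; lia.
exists q; split=> //; last 1 first.
- apply: subseq_uniq up; rewrite /= eqxx -[X in subseq _ X](cat_take_drop i p).
  apply: cat_subseq => //.
  by have -> : j.-1 = j.-1 - i + i by [lia]; rewrite -drop_drop drop_subseq.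
- have step : link_rel U (nth x (x :: p) i) (nth x (x :: p) j).
    rewrite link_relE ijadj andbT; apply/andP; split.
      case: (posnP i) => [i0|i0]; first subst i; last first.
        rewrite -(prednK i0) /=; apply: (allP xpU); apply: mem_nth.
        exact: leq_ltn_trans (leq_pred i) ip.
      by move: xp ip; case: (p) => //= z s /andP[/and3P[]].
    by rewrite jj /=; apply: (allP xpU); apply: mem_nth; rewrite -jj.
  rewrite cat_path lasttake ?dropj /=; last lia.
  rewrite step /=.
  have := xp; rewrite -{1}(cat_take_drop i p) cat_path => /andP[-> _].
  have := xp; rewrite -{1}(cat_take_drop j p) cat_path => /andP[_].
  by rewrite lasttake.
by rewrite /q last_cat dropj /= -px -[in RHS](cat_take_drop j p) last_cat lasttake.
Qed.

Lemma linked_ipath U x y : linked U x y -> x \in U -> exists f l,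
  [/\ ipath f l, f 0 = x, f l = y & forall i, i <= l -> f i \in U].
Proof.
move=> /linked_shortest[p [[[xp px up] ind] pU]] xU.
have key i j : i < j <= size p -> nth x (x :: p) i != nth x (x :: p) j /\
   adj (nth x (x :: p) i) (nth x (x :: p) j) = (j == i.+1).
  move=> ij; split; first by rewrite nth_uniq //=; lia.
  apply/idP/eqP; first exact: ind.
  move=> ji; subst j.
  by have /pathP := xp => /(_ x i); apply; lia.
exists (nth x (x :: p)), (size p); split=> //.
- move=> i j ip jp; have [ij|ij|->] := ltngtP i j.
  + by have [|n1 n2] := key i j; [lia | split; [apply/negbTE | rewrite n2]; lia].
  + have [|n1 n2] := key j i; first lia.
    by split; [rewrite eq_sym; apply/negbTE | rewrite adj_sym n2]; lia.
  + by rewrite !eqxx adj_irrefl; split=> //; lia.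
- by rewrite -px -nth_last /=; case: (p) => //= v s; rewrite nth_last.
- by case=> //= i ip; apply: (allP pU); apply: mem_nth.
Qed.

Lemma ipath_le f l m : ipath f l -> m <= l -> ipath f m.
Proof.
by move=> fl ml i j im jm; apply: fl; [apply: leq_trans im ml | apply: leq_trans jm ml].
Qed.

Lemma ipath_link U f l i j : ipath f l -> i <= j -> j <= l ->
  (forall s, i <= s <= j -> f s \in U) -> linked U (f i) (f j).
Proof.
elim: j => [|j IH] fl ij jl fU.
  by move: ij; rewrite leqn0 => /eqP->; apply: linked_refl.
have [->|lt] := eqVneq i j.+1; first exact: linked_refl.
have ij' : i <= j by lia.
apply: (@linked_trans _ (f j)).
  by apply: IH => // [|s ?]; [exact: ltnW | apply: fU; lia].
apply: linked1; [by apply: fU; lia | by apply: fU; lia |].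
by have [|//|_ ->] := fl j j.+1; [lia | rewrite eqxx].
Qed.

(** Half-open: index [j] is excluded, so a whole path of length [l] is [seg f 0 l.+1], and
    [seg f 0 0] is empty. *)
Definition seg f i j : {set G} := [set u | [exists s : 'I_j, (i <= s) && (u == f s)]].

Lemma segP f i j u : reflect (exists2 s, i <= s < j & u = f s) (u \in seg f i j).
Proof.
rewrite inE; apply: (iffP existsP) => [[s /andP[si /eqP us]]|[s /andP[si sj] us]].
  by exists s; rewrite ?si ?ltn_ord.
by exists (Ordinal sj); rewrite /= si us eqxx.
Qed.

Lemma mem_seg f i j s : i <= s < j -> f s \in seg f i j.
Proof. by move=> ?; apply/segP; exists s. Qed.

(** An induced path towards [D] is stopped at the first vertex that has a neighbour in [D], so only
    its last vertex sees [D]. No earlier vertex lies in [D], since its predecessor would have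
    stopped the path. *)
Lemma approach U (D : {set G}) x y : linked U y x -> x \in D -> y \notin D -> y \in U ->
  exists f m, [/\ ipath f m /\ f 0 = y, forall s, s <= m -> f s \in U /\ f s \notin D,
    exists2 z, z \in D & adj (f m) z &
    forall s z, s < m -> z \in D -> ~~ adj (f s) z].
Proof.
move=> yx xD yD yU; have [f [l [fl f0 flx fU]]] := linked_ipath yx yU.
pose P s := (s <= l) && [exists z in D, adj (f s) z].
have prv s : s <= l -> f s \in D -> (0 < s) /\ P s.-1.
  case: s => [|s] sl sD; first by rewrite f0 (negPf yD) in sD.
  split=> //; rewrite /P /= (ltnW sl); apply/existsP; exists (f s.+1); rewrite sD.
  by have [|//|_ ->] := fl s s.+1; [exact: ltnW | rewrite eqxx].
have exP : exists s, P s by exists l.-1; apply: (prv l _ _).2; rewrite ?flx.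
case: (ex_minnP exP) => m /andP[ml /existsP[z /andP[zD mz]]] mmin.
exists f, m; split; [|move=> s sm|by exists z|].
- by split=> //; apply: ipath_le ml.
- have sl := leq_trans sm ml; split; first exact: fU.
  by apply/negP=> /(prv _ sl)[s0 /mmin ms]; lia.
move=> s v sm vD; apply/negP=> adjv; suff /mmin : P s by lia.
by rewrite /P (leq_trans (ltnW sm) ml); apply/existsP; exists v; rewrite vD.
Qed.

End Linkage.

(** Used with [P] the indices at which a vertex sees a path: first and last neighbour coincide, are
    consecutive, or leave a gap. *)
Lemma extreme_indices (P : pred nat) l s : s <= l -> P s -> exists i j,
  [/\ P i, P j, i <= j <= l & forall r, r <= l -> P r -> i <= r <= j].
Proof.
move=> sl Ps; pose Q r := (r <= l) && P r.
have exQ : exists r, Q r by exists s; rewrite /Q sl.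
have ubQ r : Q r -> r <= l by case/andP.
case: (ex_minnP exQ) => i /andP[il Pi] imin; case: (ex_maxnP exQ ubQ) => j /andP[jl Pj] jmax.
exists i, j; split=> //; first by rewrite jl imin /Q ?jl.
by move=> r rl Pr; rewrite imin ?jmax // /Q rl.
Qed.

(** * Thetas and prisms *)

Section Configurations.
Variable G : sgraph.
Implicit Types (u v x y z : G) (U V Q : {set G}).

Lemma lift_seq U (p : seq G) : all (mem U) p ->
  exists q : seq (induced U), map val q = p.
Proof.
elim: p => [|x p IH] /=; first by exists [::].
by case/andP=> xU /IH[q <-]; exists (exist _ x xU :: q).
Qed.

Lemma lift_induced_path U (x y : induced U) p :
  is_induced_path (val x) (val y) p -> all (mem U) p ->
  exists q : seq (induced U), map val q = p /\ is_induced_path x y q.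
Proof.
move=> [[xp py up] ind] /lift_seq[q qp]; exists q; split=> //.
subst p; split; first split.
- by move: xp; rewrite path_map.
- by apply: val_inj; rewrite -py last_map.
- by move: up; rewrite -map_cons map_inj_uniq //; exact: val_inj.
move=> i j ij adjij; apply: ind; first by rewrite size_map.
have [lt jq] := andP ij; have iq := leq_trans (ltnW lt) jq.
by rewrite -map_cons !(nth_map x) /=.
Qed.

Definition apart Q1 Q2 := forall u v, u \in Q1 -> v \in Q2 -> (u != v) && ~~ adj u v.

Lemma apart_sym Q1 Q2 : apart Q1 Q2 -> apart Q2 Q1.
Proof. by move=> s u v uQ vQ; have := s _ _ vQ uQ; rewrite eq_sym adj_sym. Qed.

Lemma apartU Q1 Q2 Q3 : apart Q1 Q3 -> apart Q2 Q3 -> apart (Q1 :|: Q2) Q3.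
Proof. by move=> s t u v; rewrite inE => /orP[uQ|uQ] vQ; [apply: s | apply: t]. Qed.

Lemma apartUr Q1 Q2 Q3 : apart Q3 Q1 -> apart Q3 Q2 -> apart Q3 (Q1 :|: Q2).
Proof. by move=> s t; apply: apart_sym; apply: apartU; apply: apart_sym. Qed.

Lemma apartS Q1 Q2 Q3 Q4 : Q1 \subset Q2 -> Q3 \subset Q4 -> apart Q2 Q4 -> apart Q1 Q3.
Proof. by move=> /subsetP s /subsetP t st u v /s us /t vt; apply: st. Qed.

(** A shortest path from [c] to [y] through [Q i] is induced with interior in [Q i], and has length
    at least two because the ends are not adjacent. *)
Lemma theta_contra (c y : G) (Q : 'I_3 -> {set G}) : theta_prism_free G ->
  c != y -> ~~ adj c y -> (forall i, linked (c |: (y |: Q i)) c y) ->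
  (forall i j, i != j -> apart (Q i) (Q j)) -> False.
Proof.
move=> free cy ncy lnk sep.
have [P PP] : exists P : 'I_3 -> seq G, forall i,
   is_induced_path c y (P i) /\ all (mem (c |: (y |: Q i))) (P i).
  have [P0 h0] := linked_shortest (lnk (inord 0)).
  have [P1 h1] := linked_shortest (lnk (inord 1)).
  have [P2 h2] := linked_shortest (lnk (inord 2)).
  exists (fun i : 'I_3 => nth [::] [:: P0; P1; P2] i) => i.
  by rewrite -(inord_val i); case: i => -[|[|[|//]]] /= ?; rewrite inordK.
(* Only the vertices of the chosen paths are kept, since [is_theta] asks the paths to cover the
   whole graph. *)
pose U := [set z | [exists i, z \in c :: P i]].
have cU : c \in U by rewrite inE; apply/existsP; exists ord0; rewrite mem_head.
have yU : y \in U.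
  rewrite inE; apply/existsP; exists ord0; have [[[_ <- _] _] _] := PP ord0.
  exact: mem_last.
have PU i : all (mem U) (P i).
  by apply/allP=> z zP; rewrite /= inE; apply/existsP; exists i; rewrite inE zP orbT.
pose c' : induced U := exist _ c cU; pose y' : induced U := exist _ y yU.
have lft i := @lift_induced_path U c' y' (P i) (PP i).1 (PU i).
have [P' PP'] : exists P' : 'I_3 -> seq (induced U), forall i,
    map val (P' i) = P i /\ is_induced_path c' y' (P' i).
  have [P0 h0] := lft (inord 0).
  have [P1 h1] := lft (inord 1).
  have [P2 h2] := lft (inord 2).
  exists (fun i : 'I_3 => nth [::] [:: P0; P1; P2] i) => i.
  by rewrite -(inord_val i); case: i => -[|[|[|//]]] /= ?; rewrite inordK.
have intQ i (z : induced U) : z \in interior c' y' (P' i) -> val z \in Q i.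
  rewrite !inE negb_or -!(inj_eq val_inj) /= => /andP[/andP[nc ny]].
  rewrite (negPf nc) /= => zP; have [_ /allP/(_ (val z))] := PP i.
  rewrite /= !inE (negPf nc) (negPf ny) /=; apply.
  by have [<- _] := PP' i; apply: map_f.
have [nth _] := free U; apply: nth.
exists c', y', P'; split.
- by split=> //; apply: contra cy => /eqP[->].
- move=> i; split; first by have [] := PP' i.
  have [_ [[xp lp _] _]] := PP' i.
  case: (P' i) xp lp => [|v [|w s]] //=.
    by move=> _ [e]; rewrite e eqxx in cy.
  rewrite andbT => vy e; move: ncy vy; rewrite -[y]/(val y') -e.
  by rewrite /induced_adj /= => /negPf->.
- move=> i j ij; split.
    apply/pred0P=> z /=; apply/negP=> /andP[/intQ zi /intQ zj].
    by have /andP[] := sep _ _ ij _ _ zi zj; rewrite eqxx.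
  by move=> u v /intQ ui /intQ vj; have /andP[_] := sep _ _ ij _ _ ui vj.
move=> z; have := valP z; rewrite inE => /existsP[i zi]; exists i.
have [e _] := PP' i; move: zi.
by rewrite -e -[c]/(val c') -map_cons mem_map //; exact: val_inj.
Qed.

(** One branch of a theta: [Q] is entered at [q] and left at [n], possibly the same vertex. Mostly
    [y] is [a] and [n] one of its neighbours. *)
Definition via Q x y := exists q n, [/\ q \in Q, adj x q, linked Q q n & adj n y].

Lemma theta_via c y Q1 Q2 Q3 : theta_prism_free G -> c != y -> ~~ adj c y ->
  via Q1 c y -> via Q2 c y -> via Q3 c y ->
  apart Q1 Q2 -> apart Q1 Q3 -> apart Q2 Q3 -> False.
Proof.
move=> free cy ncy v1 v2 v3 s12 s13 s23.
have lnk Q : via Q c y -> linked (c |: (y |: Q)) c y.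
  move=> [q [n [qQ cq qn ny]]].
  have nQ := linked_mem qn qQ.
  have sub : Q \subset c |: (y |: Q) by rewrite setUA subsetUr.
  apply: (@linked_trans _ _ q); first by apply: linked1; rewrite ?inE ?eqxx ?qQ ?orbT.
  apply: (@linked_trans _ _ n); first exact: linkedS sub qn.
  by apply: linked1; rewrite ?inE ?eqxx ?nQ ?orbT.
apply: (@theta_contra c y (fun i : 'I_3 => nth set0 [:: Q1; Q2; Q3] i) free cy ncy).
  by case=> -[|[|[|//]]] /= _; apply: lnk.
case=> -[|[|[|//]]] /= ? [[|[|[|//]]] /= ?] // _; by [ | apply: apart_sym].
Qed.

(** The condition on two sides of a prism: disjoint, with at most the two triangle edges between
    them. *)
Definition only_edges Q1 Q2 x y x' y' := forall u v, u \in Q1 -> v \in Q2 ->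
  u != v /\ (adj u v -> (u = x /\ v = y) \/ (u = x' /\ v = y')).

Lemma prism_contra (s t : 'I_3 -> G) (Q : 'I_3 -> {set G}) : theta_prism_free G ->
  (forall i j, i != j -> adj (s i) (s j) /\ adj (t i) (t j)) ->
  (forall i, s i != t i) ->
  (forall i, s i \in Q i) -> (forall i, linked (Q i) (s i) (t i)) ->
  (forall i j, i != j -> only_edges (Q i) (Q j) (s i) (s j) (t i) (t j)) -> False.
Proof.
move=> free tri st sQ lnk sep.
have tQ i := linked_mem (lnk i) (sQ i).
have [P PP] : exists P : 'I_3 -> seq G, forall i,
   is_induced_path (s i) (t i) (P i) /\ all (mem (Q i)) (P i).
  have [P0 h0] := linked_shortest (lnk (inord 0)).
  have [P1 h1] := linked_shortest (lnk (inord 1)).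
  have [P2 h2] := linked_shortest (lnk (inord 2)).
  exists (fun i : 'I_3 => nth [::] [:: P0; P1; P2] i) => i.
  rewrite -(inord_val i); move: h0 h1 h2.
  by case: i => -[|[|[|//]]] /= ?; rewrite inordK.
pose U := [set z | [exists i, z \in s i :: P i]].
have sU i : s i \in U by rewrite inE; apply/existsP; exists i; rewrite mem_head.
have tU i : t i \in U.
  rewrite inE; apply/existsP; exists i; have [[[_ <- _] _] _] := PP i.
  exact: mem_last.
have PU i : all (mem U) (P i).
  by apply/allP=> z zP; rewrite /= inE; apply/existsP; exists i; rewrite inE zP orbT.
pose s' i : induced U := exist _ (s i) (sU i); pose t' i : induced U := exist _ (t i) (tU i).
have lft i := @lift_induced_path U (s' i) (t' i) (P i) (PP i).1 (PU i).
have [P' PP'] : exists P' : 'I_3 -> seq (induced U), forall i,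
    map val (P' i) = P i /\ is_induced_path (s' i) (t' i) (P' i).
  have [P0 h0] := lft (inord 0).
  have [P1 h1] := lft (inord 1).
  have [P2 h2] := lft (inord 2).
  exists (fun i : 'I_3 => nth [::] [:: P0; P1; P2] i) => i.
  rewrite -(inord_val i); move: h0 h1 h2.
  by case: i => -[|[|[|//]]] /= ?; rewrite inordK.
have memQ i (z : induced U) : z \in s' i :: P' i -> val z \in Q i.
  rewrite inE => /predU1P[->|zP]; first exact: sQ.
  have [_ /allP/(_ (val z))] := PP i; apply.
  by have [<- _] := PP' i; apply: map_f.
have ne i j : i != j -> forall u v, u \in Q i -> v \in Q j -> u != v.
  by move=> ij u v ui vj; have [] := sep _ _ ij _ _ ui vj.
have [_ npr] := free U; apply: npr.
exists s', t', P'; split.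
- split; first by move=> i j ij; have [] := tri i j ij.
  move=> i j; apply/eqP=> -[e].
  have [ij|ij] := eqVneq i j; first by subst j; have := st i; rewrite e eqxx.
  by have := ne _ _ ij _ _ (sQ i) (tQ j); rewrite e eqxx.
- by move=> i; have [] := PP' i.
- move=> i j ij; apply/pred0P=> z; apply/negP=> /andP[/memQ zi /memQ zj].
  by have := ne _ _ ij _ _ zi zj; rewrite eqxx.
- move=> i j u v ij /memQ ui /memQ vj uv.
  have [_ /(_ uv)] := sep _ _ ij _ _ ui vj.
  by case=> -[eu ev]; [left | right]; split; apply: val_inj.
move=> z; have := valP z; rewrite inE => /existsP[i zi]; exists i.
have [e _] := PP' i; move: zi.
by rewrite -e -[s i]/(val (s' i)) -map_cons mem_map //; exact: val_inj.
Qed.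

Lemma no_prism s1 s2 s3 t1 t2 t3 Q1 Q2 Q3 : theta_prism_free G ->
  [/\ adj s1 s2, adj s1 s3 & adj s2 s3] -> [/\ adj t1 t2, adj t1 t3 & adj t2 t3] ->
  [/\ s1 != t1, s2 != t2 & s3 != t3] -> [/\ s1 \in Q1, s2 \in Q2 & s3 \in Q3] ->
  [/\ linked Q1 s1 t1, linked Q2 s2 t2 & linked Q3 s3 t3] ->
  only_edges Q1 Q2 s1 s2 t1 t2 -> only_edges Q1 Q3 s1 s3 t1 t3 ->
  only_edges Q2 Q3 s2 s3 t2 t3 -> False.
Proof.
move=> free [a12 a13 a23] [b12 b13 b23] [n1 n2 n3] [m1 m2 m3] [l1 l2 l3] o12 o13 o23.
have oS Q Q' x y x' y' : only_edges Q Q' x y x' y' -> only_edges Q' Q y x y' x'.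
  move=> o u v uQ vQ; have [ne h] := o _ _ vQ uQ; rewrite eq_sym adj_sym; split=> //.
  by case/h=> -[-> ->]; [left | right].
apply: (@prism_contra (fun i : 'I_3 => nth s1 [:: s1; s2; s3] i)
  (fun i : 'I_3 => nth s1 [:: t1; t2; t3] i) (fun i : 'I_3 => nth set0 [:: Q1; Q2; Q3] i) free).
- by case=> -[|[|[|//]]] /= ? [[|[|[|//]]] /= ?] // _; split=> //; rewrite adj_sym.
- by case=> -[|[|[|//]]] /=.
- by case=> -[|[|[|//]]] /=.
- by case=> -[|[|[|//]]] /=.
case=> -[|[|[|//]]] /= ? [[|[|[|//]]] /= ?] // _; by [ | apply: oS].
Qed.

End Configurations.

(** * Maximal tripods *)

Section Tripod.
Variables (G : sgraph) (a : G).
Implicit Types (A K : 'I_3 -> {set G}) (u v x y z p n : G).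

(** The vertices of a part that see no other part. As cores are connected and meet the neighbours of
    [a], every core vertex reaches [a] through its own core. *)
Definition core A K i : {set G} := A i :\: K i.

(* A strip structure over a claw, whose three leaves are merged into [a]. *)
Record tripod A K : Prop := Tripod {
  tp_sub : forall i, K i \subset A i;
  tp_a : forall i, a \notin A i;
  tp_disj : forall i j u, i != j -> u \in A i -> u \notin A j;
  tp_adj : forall i j u v, i != j -> u \in A i -> v \in A j ->
    adj u v = (u \in K i) && (v \in K j);
  tp_conn : forall i u v, u \in core A K i -> v \in core A K i -> linked (core A K i) u v;
  tp_K : forall i u, u \in K i -> exists2 v, v \in core A K i & adj u v;
  tp_b : forall i, exists b, b \in K i;
  tp_n : forall i, exists2 n, n \in core A K i & adj a n;
  tp_N : forall n, adj a n -> exists i, n \in core A K i }.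

Definition extends A K A' K' := forall i, A i \subset A' i /\ K i \subset K' i.

(** Maximality concerns the parts only; an extension contradicts it by placing one new vertex in a
    part. *)
Definition full A K := forall A' K', tripod A' K' -> extends A K A' K' ->
  forall i, A' i \subset A i.

Lemma full_extension A K : tripod A K -> exists A' K',
  [/\ tripod A' K', extends A K A' K' & full A' K'].
Proof.
have [m] := ubnP (\sum_i #|~: A i|); elim: m A K => // m IH A K lem T.
have [fAK|nf] := classic (full A K); first by exists A, K; split=> // i; rewrite !subxx.
have [A' [K' [T' ext [i ni]]]] : exists A' K', [/\ tripod A' K', extends A K A' K' &
    exists i, ~~ (A' i \subset A i)].
  apply: NNPP => h; apply: nf => A' K' T' ext i; apply/negPn/negP=> ni.
  by apply: h; exists A', K'; split=> //; exists i.
have lt : \sum_i #|~: A' i| < m.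
  apply: leq_trans (lem : _ <= m).
  rewrite (bigD1 i) //= [in leqRHS](bigD1 i) //= -addSn leq_add //; last first.
    by apply: leq_sum => j _; apply: subset_leq_card; rewrite setCS; case: (ext j).
  apply: proper_card; rewrite properE !setCS ni andbT; by case: (ext i).
have [A'' [K'' [T'' ext'' f'']]] := IH A' K' lt T'.
exists A'', K''; split=> // j; have [s1 s2] := ext j; have [s3 s4] := ext'' j.
by rewrite (subset_trans s1) ?(subset_trans s2).
Qed.

(** Used with [true] for the parts and with a boolean [c] for the interfaces: the new vertex always
    enters the part [i0], and its interface exactly when [c] holds. *)
Definition add_at (c : bool) i0 p A i := if (i == i0) && c then p |: A i else A i.

(** The core neighbour of [p] serves both cases: it keeps the core connected if [p] joins the core,
    and is the required core neighbour if [p] joins the interface. Adjacency of [p] inside [A i0] is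
    otherwise free. *)
Lemma tripod_add A K i0 p c : tripod A K -> p != a -> (forall i, p \notin A i) ->
  (exists2 u, u \in core A K i0 & adj p u) ->
  (forall j u, j != i0 -> u \in A j -> adj p u = c && (u \in K j)) ->
  tripod (add_at true i0 p A) (add_at c i0 p K).
Proof.
move=> T pa pA [w wc pw] padj.
have pK i : p \notin K i by apply: contra (pA i); apply/subsetP/(tp_sub T).
have A1 i u : (u \in add_at true i0 p A i) = (u \in A i) || ((i == i0) && (u == p)).
  by rewrite /add_at andbT; case: eqP => _; rewrite ?inE ?orbF // orbC.
have K1 i u : (u \in add_at c i0 p K i) = (u \in K i) || [&& c, i == i0 & u == p].
  by rewrite /add_at; case: eqP => _ /=; case: (c); rewrite ?inE ?orbF // orbC.
have C1 i u : (u \in core (add_at true i0 p A) (add_at c i0 p K) i) =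
    (u \in core A K i) || [&& ~~ c, i == i0 & u == p].
  rewrite /core !inE A1 K1 negb_or.
  have [->|] := eqVneq u p; first by rewrite (negPf (pA i)) (negPf (pK i)) /=; case: eqP; case: (c).
  by rewrite !andbF !orbF !andbT.
have CS i : core A K i \subset core (add_at true i0 p A) (add_at c i0 p K) i.
  by apply/subsetP=> u ui; rewrite C1 ui.
split.
- move=> i; apply/subsetP=> u; rewrite A1 K1.
  by case/orP=> [/(subsetP (tp_sub T i)) -> //|/and3P[_ -> ->]]; rewrite orbT.
- by move=> i; rewrite A1 (negPf (tp_a T i)) [a == p]eq_sym (negPf pa) andbF.
- move=> i j u ij; rewrite !A1 => /orP[ui|/andP[/eqP ei /eqP->]].
    rewrite (negPf (tp_disj T ij ui)) /=; apply/negP=> /andP[_ /eqP up].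
    by move: (pA i); rewrite -up ui.
  by rewrite (negPf (pA j)) /= -ei eq_sym (negPf ij).
- move=> i j u v ij; rewrite !A1 !K1.
  have [->|_] := eqVneq u p; have [->|_] := eqVneq v p.
  + rewrite !(negPf (pA _)) !(negPf (pK _)) /= !andbT => /eqP e1 /eqP e2.
    by rewrite e1 e2 eqxx in ij.
  + rewrite !(negPf (pA _)) !(negPf (pK _)) /= !andbT !andbF !orbF => /eqP e1 vj.
    by rewrite e1 in ij *; rewrite (padj j v) 1?eq_sym // eqxx andbT.
  + rewrite !(negPf (pA _)) !(negPf (pK _)) /= !andbT !andbF !orbF => ui /eqP e1.
    by rewrite e1 in ij *; rewrite adj_sym (padj i u) // eqxx andbT andbC.
  + by rewrite !andbF !orbF; apply: (tp_adj T).
- move=> i u v; rewrite !C1.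
  have lk z z' : z \in core A K i -> z' \in core A K i ->
      linked (core (add_at true i0 p A) (add_at c i0 p K) i) z z'.
    by move=> zi zi'; apply: linkedS (CS i) _; apply: (tp_conn T).
  have pl z : [&& ~~ c, i == i0 & z == p] ->
      linked (core (add_at true i0 p A) (add_at c i0 p K) i) z w.
    move=> /and3P[nc ei /eqP->]; apply: linked1 => //; rewrite C1 ?eqxx ?nc ?ei ?orbT //.
    by rewrite (eqP ei) wc.
  have wi z : [&& ~~ c, i == i0 & z == p] -> w \in core A K i.
    by case/and3P=> _ /eqP->.
  case/orP=> uh /orP[] vh; first exact: lk.
  + by rewrite linked_sym; apply: linked_trans (pl v vh) _; apply: lk => //; apply: wi vh.
  + by apply: linked_trans (pl u uh) _; apply: lk => //; apply: wi uh.
  + by apply: linked_trans (pl u uh) _; rewrite linked_sym; apply: pl.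
- move=> i u; rewrite K1 => /orP[/(tp_K T)[v vc uv]|/and3P[_ /eqP -> /eqP->]].
    by exists v => //; rewrite C1 vc.
  by exists w => //; rewrite C1 wc.
- by move=> i; have [b bi] := tp_b T i; exists b; rewrite K1 bi.
- by move=> i; have [n ni an] := tp_n T i; exists n => //; rewrite C1 ni.
by move=> n /(tp_N T)[i ni]; exists i; rewrite C1 ni.
Qed.

Lemma full_add A K i0 p c : tripod A K -> full A K -> p != a -> (forall i, p \notin A i) ->
  (exists2 u, u \in core A K i0 & adj p u) ->
  (forall j u, j != i0 -> u \in A j -> adj p u = c && (u \in K j)) -> False.
Proof.
move=> T F pa pA pw padj; have T' := tripod_add T pa pA pw padj.
have ext : extends A K (add_at true i0 p A) (add_at c i0 p K).
  by move=> i; rewrite /add_at; split; case: ifP => _; rewrite ?subsetUr.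
have /subsetP/(_ p) := F _ _ T' ext i0.
by rewrite /add_at eqxx /= inE in_set1 eqxx (negPf (pA i0)) => /(_ isT).
Qed.

End Tripod.

(** * Jewels *)

Lemma other_indices (i : 'I_3) : exists j k,
  [/\ i != j, i != k, j != k & forall x, x = i \/ (x = j \/ x = k)].
Proof.
by case: i => -[|[|[|//]]] ?; [exists (inord 1), (inord 2) | exists (inord 0), (inord 2) |
  exists (inord 0), (inord 1)]; split; rewrite -?(inj_eq val_inj) /= ?inordK //;
  case=> -[|[|[|//]]] ?; ((by left; apply: val_inj) || right);
  ((by left; apply: val_inj; rewrite /= inordK) || by right; apply: val_inj; rewrite /= inordK).
Qed.

(** Runs [lia] after clearing the graph-theoretic hypotheses, to keep its context small. *)
Ltac nlia := intros; repeat match goal with H : ?P |- _ => lazymatch P with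
  | is_true (leq _ _) => fail | is_true (_ && _) => fail | is_true (_ || _) => fail
  | is_true (~~ (?x == _)) => lazymatch type of x with nat => fail | _ => clear H end
  | is_true (?x == _) => lazymatch type of x with nat => fail | _ => clear H end
  | @eq nat _ _ => fail | @eq bool _ _ => fail | nat => fail
  | or _ _ => fail | and _ _ => fail | _ => clear H end end; lia.

Section Jewels.
Variables (G : sgraph) (a : G) (A K : 'I_3 -> {set G}).
Hypothesis free : theta_prism_free G.
Hypothesis pendant : forall n u v : G,
  adj a n -> adj n u -> adj n v -> u != a -> v != a -> u = v.
Hypothesis T : tripod a A K.
Implicit Types (u v x y z p n : G) (i j k : 'I_3).

Let C := core A K.
(** The core without the neighbours of [a]: a set that can carry a path with no edge to [a]. *)
Let W i := C i :\: nbhd a.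

Lemma core_sub i : C i \subset A i.
Proof. exact: subsetDl. Qed.

Lemma core_A i u : u \in C i -> u \in A i.
Proof. by move/(subsetP (core_sub i)). Qed.

Lemma W_core i u : u \in W i -> u \in C i.
Proof. by rewrite inE => /andP[]. Qed.

Lemma W_nadj i u : u \in W i -> ~~ adj a u.
Proof. by rewrite !inE => /andP[]. Qed.

Lemma K_A i u : u \in K i -> u \in A i.
Proof. exact: (subsetP (tp_sub T i)). Qed.

Lemma A_neq i u : u \in A i -> u != a.
Proof. by apply: contraTneq => ->; apply: (tp_a T i). Qed.

Lemma core_K i u : u \in C i -> u \notin K i.
Proof. by rewrite inE => /andP[]. Qed.

Lemma term_core i u : adj a u -> u \in A i -> u \in C i.
Proof.
move=> /(tp_N T)[j uj] ui; have [<-//|ij] := eqVneq j i.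
by have := tp_disj T ij (core_A uj); rewrite ui.
Qed.

Lemma K_nadj i u : u \in K i -> ~~ adj a u.
Proof.
move=> uK; apply/negP=> /term_core/(_ (K_A uK)).
by rewrite inE uK.
Qed.

Lemma apart_core i j : i != j -> apart (C i) (A j).
Proof.
move=> ij u v ui vj; have uA := core_A ui.
rewrite (tp_adj T ij uA vj) (negPf (core_K ui)) andbT.
apply: contraTneq vj => <-. exact: (tp_disj T ij uA).
Qed.

(** An inner vertex of an induced path in the core has two different neighbours other than [a], so
    by [pendant] it does not see [a]. *)
Lemma core_link i u v : u \in C i -> v \in W i -> linked (u |: W i) u v.
Proof.
move=> ui vW; have uv := tp_conn T ui (W_core vW).
have [f [l [fl f0 flv fC]]] := linked_ipath uv ui.
rewrite -f0 -flv; apply: (ipath_link fl) => // s /= sl.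
rewrite in_setU1; case: s sl => [|s] sl; first by rewrite f0 eqxx.
apply/orP; right; have [->|ne] := eqVneq s.+1 l; first by rewrite flv.
rewrite in_setD fC // andbT inE; apply/negP=> as1.
have ssl : s.+2 <= l by nlia.
have [_ e1] := fl s.+1 s sl (ltnW sl).
have [_ e2] := fl s.+1 s.+2 sl ssl.
have [e3 _] := fl s s.+2 (ltnW sl) ssl.
have := pendant as1 (u := f s) (v := f s.+2).
rewrite e1 e2 !eqxx orbT => /(_ isT isT).
have -> : f s != a by apply: (@A_neq i); apply: core_A; apply: fC; nlia.
have -> : f s.+2 != a by apply: (@A_neq i); apply: core_A; apply: fC.
by move=> /(_ isT isT) /eqP; rewrite e3; nlia.
Qed.

(** The single neighbour of [n] besides [a] already lies in [A i]. *)
Lemma term_out i n p : n \in C i -> adj a n -> p \notin A i -> p != a -> ~~ adj p n.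
Proof.
move=> ni an pA pa; apply/negP=> pn.
have [b bK] := tp_b T i; have [u uC bu] := tp_K T bK.
suff [q qA nq] : exists2 q, q \in A i & adj n q.
  by move: pA; rewrite (pendant an (u := p) (v := q)) ?qA // 1?adj_sym //; apply: (A_neq qA).
have [un|un] := eqVneq n u; first by exists b; rewrite ?K_A // adj_sym un.
have [q [_ qC nq _]] := linked_step (tp_conn T ni uC) un.
by exists q => //; apply: core_A.
Qed.

(** If the core neighbour of [y] sees [a], then [y] is its only other neighbour, which cuts it off
    from [w] although the core is connected. *)
Lemma K_step i y w : y \in K i -> w \in W i -> exists2 v, v \in W i & adj y v.
Proof.
move=> yK wW; have [v vC yv] := tp_K T yK.
have [av|av] := boolP (adj a v); last by exists v; rewrite // !inE in vC * => //; rewrite av.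
have vw : v != w by apply: contraTneq wW => <-; rewrite !inE av.
have [z [_ zW vz _]] := linked_step (core_link vC wW) vw.
have zW' : z \in W i.
  by move: zW; rewrite in_setU1 => /predU1P[e|//]; rewrite e adj_irrefl in vz.
have e : y = z.
  apply: (pendant av) vz _ _; first by rewrite adj_sym.
    exact: (A_neq (K_A yK)).
  exact: (A_neq (core_A (W_core zW'))).
by move: (core_K (W_core zW')); rewrite -e yK.
Qed.

Lemma core_term i u : u \in A i -> exists n,
  [/\ n \in C i, adj n a & linked (u |: C i) u n].
Proof.
move=> ui; have [n nC an] := tp_n T i; exists n; split=> //; first by rewrite adj_sym.
have sub : C i \subset u |: C i by apply: subsetUr.
have [uK|uK] := boolP (u \in K i).
  have [v vC uv] := tp_K T uK.
  apply: (@linked_trans _ _ v); first by apply: linked1; rewrite ?setU11 ?setU1r.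
  exact: (linkedS sub (tp_conn T vC nC)).
by apply: (linkedS sub (tp_conn T _ nC)); rewrite inE uK.
Qed.

Lemma via_A i u c : u \in A i -> adj c u -> via (u |: C i) c a.
Proof.
by move=> /core_term[n [nC na un]] cu; exists u, n; split=> //; exact: setU11.
Qed.

Lemma via_core i u c : u \in C i -> adj c u -> via (C i) c a.
Proof.
move=> uC cu; have [n [nC na un]] := core_term (core_A uC).
by exists u, n; split=> //; move: un; rewrite (setUidPr _) // sub1set.
Qed.

Lemma out_nadj p : p != a -> (forall i, p \notin A i) -> ~~ adj p a.
Proof.
move=> pa pA; rewrite adj_sym; apply/negP=> /(tp_N T)[i /core_A].
by rewrite (negPf (pA i)).
Qed.

Lemma apart_A1 i j u : i != j -> u \in A i -> apart (u |: C i) (C j).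
Proof.
move=> ij uA; apply: apart_sym; apply: (apartS _ _ (@apart_core j i _)) => //.
  by apply/subsetP=> z; rewrite in_setU1 => /predU1P[->//|/core_A].
by rewrite eq_sym.
Qed.

(** Otherwise the three parts carry the branches of a theta with ends [p] and [a]; as two of them
    stay in cores, the third may start in an interface. *)
Lemma outside_two i j k p u v w : i != j -> i != k -> j != k ->
  p != a -> (forall i, p \notin A i) ->
  u \in C i -> v \in C j -> w \in A k -> adj p u -> adj p v -> ~~ adj p w.
Proof.
move=> ij ik jk pa pA uC vC wA pu pv; apply/negP=> pw.
apply: (theta_via free pa (out_nadj pa pA) (via_core uC pu) (via_core vC pv) (via_A wA pw)).
- by apply: (apartS _ _ (apart_core ij)); rewrite ?core_sub.
- by apply: apart_sym; apply: apart_A1; rewrite // eq_sym.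
- by apply: apart_sym; apply: apart_A1; rewrite // eq_sym.
Qed.

(** If [p] missed [z], there would be a theta with ends [y] and [a]: its branches go through the
    core of [y], through [z] and its core, and through [p] and the core of [i]. *)
Lemma outside_K i j k p u y z : i != j -> i != k -> j != k ->
  p != a -> (forall i, p \notin A i) ->
  (forall w, w \in C j -> ~~ adj p w) -> (forall w, w \in C k -> ~~ adj p w) ->
  u \in C i -> y \in K j -> z \in K k -> adj p u -> adj p y -> adj p z.
Proof.
move=> ij ik jk pa pA pj pk uC yK zK pu py; apply/negPn/negP=> pz.
have yA := K_A yK; have zA := K_A zK.
have ya : y != a := A_neq yA.
have nya : ~~ adj y a by rewrite adj_sym (K_nadj yK).
have [v vC yv] := tp_K T yK.
have yz : adj y z by rewrite (tp_adj T jk yA zA) yK.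
have vp : via (p |: C i) y a.
  have [n [nC na un]] := core_term (core_A uC).
  exists p, n; split=> //; [exact: setU11 | by rewrite adj_sym |].
  apply: (@linked_trans _ _ u); first by apply: linked1; rewrite ?setU11 ?setU1r.
  by move: un; rewrite (setUidPr _) ?sub1set //; apply: linkedS; apply: subsetUr.
have pw i' w : w \in A i' -> p != w by apply: contraTneq => <-.
apply: (theta_via free ya nya vp (via_core vC yv) (via_A zA yz)).
- apply: apartU; last by apply: (apartS _ _ (apart_core ij)); rewrite ?core_sub.
  by move=> _ w /set1P-> wC; rewrite (pw _ _ (core_A wC)) pj.
- apply: apartU; last by apply: apart_sym; apply: apart_A1; rewrite // eq_sym.
  move=> _ w /set1P-> /setU1P[->|wC]; first by rewrite (pw _ _ zA).
  by rewrite (pw _ _ (core_A wC)) pk.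
- by apply: apart_sym; apply: apart_A1; rewrite // eq_sym.
Qed.

(* Relative to a maximal tripod, every outside vertex that sees a core is a jewel;
   jewels need not vanish, as the line graph of a triangle with three pendant edges shows. *)
Definition jewel i j k p := [/\ p != a, forall i', p \notin A i',
  exists2 u, u \in C i & adj p u, exists2 u, u \in C j & adj p u &
  forall u, u \in A k -> ~~ adj p u].

(** An induced path from [p] through one core to a neighbour of [a], of which only the last vertex
    sees [a]. *)
Definition leg i p (d : nat -> G) l := [/\ ipath d l, d 0 = p, d l \in C i, adj a (d l) &
  forall s, 0 < s < l -> d s \in W i].

Lemma jewel_sym i j k p : jewel i j k p -> jewel j i k p.
Proof. by case. Qed.

Lemma leg_exists i j k p : jewel i j k p -> exists d l, leg i p d l.
Proof.
case=> pa pA [u uC pu] _ _; have [n nC an] := tp_n T i.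
have uW : u \in W i.
  rewrite in_setD uC andbT inE; apply/negP=> au.
  by move: (term_out uC au (pA i) pa); rewrite pu.
have un := core_link nC uW.
have pn : linked (p |: (n |: W i)) p n.
  apply: (@linked_trans _ _ u); first by apply: linked1; rewrite ?setU11 ?setU1r.
  by rewrite linked_sym; apply: linkedS un; apply: subsetUr.
have [d [l [dl d0 dln dU]]] := linked_ipath pn (setU11 _ _).
exists d, l; split; rewrite ?dln // => s /andP[s0 sl].
have := dU s (ltnW sl); rewrite in_setU1 => /predU1P[e|].
  by have [] := dl s 0 (ltnW sl) (leq0n _); rewrite d0 e eqxx; nlia.
rewrite in_setU1 => /predU1P[e|//].
by have [] := dl s l (ltnW sl) (leqnn _); rewrite dln e eqxx; nlia.
Qed.

(** * Legs: induced paths from a jewel to the neighbours of [a] *)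

Section Leg.
Variables (i j k : 'I_3) (p : G) (d : nat -> G) (l : nat).
Hypotheses (ij : i != j) (ik : i != k) (jk : j != k).
Hypotheses (jp : jewel i j k p) (dl : leg i p d l).

Lemma leg_core s : 0 < s <= l -> d s \in C i.
Proof.
case: dl => _ _ lC _ dW /andP[s0]; rewrite leq_eqVlt => /predU1P[->//|sl].
by apply: W_core; apply: dW; rewrite s0.
Qed.

Lemma leg_a s : s <= l -> adj (d s) a = (s == l).
Proof.
case: jp dl => pa pA _ _ _ [_ d0 lC al dW] sl; rewrite adj_sym.
have [->|nsl] := eqVneq s l; first by rewrite al.
case: s nsl sl => [|s] nsl sl; first by rewrite d0 adj_sym (negPf (out_nadj pa pA)).
by apply: negbTE; apply: (@W_nadj i); apply: dW; nlia.
Qed.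

Lemma leg_neq_a s : s <= l -> d s != a.
Proof.
case: s => [|s] sl; first by case: dl => _ -> _ _ _; case: jp.
by apply: (@A_neq i); apply: core_A; apply: leg_core.
Qed.

Lemma leg_apart : apart (seg d 0 l.+1) (A k).
Proof.
case: jp dl => pa pA _ _ pk [_ d0 _ _ _].
move=> _ v /segP[[|s] sl ->] vk; last by apply: apart_core ik _ _ (leg_core _) vk.
by rewrite d0 pk // andbT; apply: contraNneq (pA k) => ->.
Qed.

Lemma leg_apart1 s : 0 < s -> apart (seg d s l.+1) (A j).
Proof.
by move=> s0 _ v /segP[r rs ->]; apply: apart_core ij _ _ _; apply: leg_core; nlia.
Qed.

Lemma leg_adj s r : s <= l -> r <= l -> adj (d s) (d r) = (r == s.+1) || (s == r.+1).
Proof. by case: dl => dp _ _ _ _ sl rl; case: (dp s r sl rl). Qed.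

Lemma leg_eq s r : s <= l -> r <= l -> (d s == d r) = (s == r).
Proof. by case: dl => dp _ _ _ _ sl rl; case: (dp s r sl rl). Qed.

Lemma leg_link s r (U : {set G}) : s <= r -> r <= l -> (forall q, s <= q <= r -> d q \in U) ->
  linked U (d s) (d r).
Proof. by case: dl => dp _ _ _ _; apply: ipath_link. Qed.

(** By [term_out] a jewel sees no neighbour of [a]. *)
Lemma leg_gt1 : 1 < l.
Proof.
case: jp dl => pa pA _ _ _ [dp d0 lC al dW].
case: l dp lC al (leg_adj (s := 0) (r := 1)) => [|[|//]] dp lC al h.
  by move: (pA i); rewrite -d0 (core_A lC).
by move: (h isT isT) (term_out lC al (pA i) pa); rewrite d0 => ->.
Qed.

Lemma leg_split s r : r < s -> apart (seg d 0 r) (seg d s l.+1).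
Proof.
move=> rs _ _ /segP[x xr ->] /segP[y ys ->].
have xl : x <= l by [nlia]; have yl : y <= l by nlia.
by rewrite leg_eq // leg_adj //; nlia.
Qed.

(** The second way from [d r] to [a]: back along the leg to [p], then through the other core. For
    [r = 0] the segment is empty and the core is entered at once. *)
Lemma leg_head_via r : r <= l -> via (seg d 0 r :|: C j) (d r) a.
Proof.
case: jp dl => _ _ _ [u uC pu] _ [_ d0 _ _ _] rl.
case: r rl => [|r] rl.
  have := via_core uC pu; rewrite d0 => -[q [n [qC pq qn na]]].
  exists q, n; split=> //; first by rewrite inE qC orbT.
  by apply: linkedS qn; apply: subsetUr.
have [n [nC na un]] := core_term (core_A uC).
exists (d r), n; split=> //.
- by rewrite inE mem_seg //; nlia.
- by rewrite leg_adj ?eqxx ?orbT //; nlia.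
apply: (@linked_trans _ _ p).
  rewrite linked_sym -d0; apply: leg_link; [nlia | nlia |].
  by move=> q qr; rewrite inE mem_seg //; nlia.
apply: (@linked_trans _ _ u).
  by apply: linked1 pu; rewrite inE ?uC ?orbT // -d0 mem_seg.
move: un; rewrite (setUidPr _) ?sub1set //; apply: linkedS; apply: subsetUr.
Qed.

Lemma leg_tail_via x r : r <= l -> adj x (d r) -> via (seg d r l.+1) x a.
Proof.
case: dl => _ _ _ al _ rl xr; exists (d r), (d l); split=> //.
- by rewrite mem_seg //; nlia.
- apply: leg_link; rewrite ?leqnn //.
  by move=> q qr; rewrite mem_seg //; nlia.
- by rewrite adj_sym.
Qed.

(* A shortest path from [y] to the leg attaches to two consecutive vertices of the leg:
   otherwise the place where it attaches is the centre of a claw whose three branches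
   reach [a], two along the leg and one through [y] and the third part. *)
Lemma leg_triangle y : y \in K i -> exists m e (E : {set G}),
  [/\ m < l, [/\ e \in E, y \in E, linked E e y & E \subset y |: W i],
      adj e (d m), adj e (d m.+1) &
      forall u s, u \in E -> s <= l ->
        u != d s /\ (adj u (d s) -> u = e /\ (s = m \/ s = m.+1))].
Proof.
move=> yK; have l1 := leg_gt1.
have d1W : d 1 \in W i by case: dl => _ _ _ _; apply.
have [w wW yw] := K_step yK d1W.
have yd1 : linked (y |: W i) y (d 1).
  apply: (@linked_trans _ _ w); first by apply: linked1; rewrite ?setU11 ?setU1r.
  have := core_link (W_core wW) d1W; rewrite (setUidPr _) ?sub1set //.
  by apply: linkedS; apply: subsetUr.
have yA := K_A yK.
have yD : y \notin seg d 0 l.+1.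
  apply/segP=> -[[|s] sl e].
    by case: jp dl => _ pA _ _ _ [_ d0 _ _ _]; move: (pA i); rewrite -d0 -e yA.
  by have := core_K (leg_core (s := s.+1) sl); rewrite -e yK.
have [f [m [[fp f0] fU [_ /segP[s0 s0l ->] fs0] fsep]]] :=
  approach yd1 (mem_seg d (i := 0) (j := l.+1) (s := 1) (ltnW l1)) yD (setU11 _ _).
set e := f m in fs0.
have [i0 [j0 [ei ej ij0 ext]]] := @extreme_indices (fun s => adj e (d s)) l s0 s0l fs0.
have eW : e \in y |: W i by case: (fU m).
have [z zK] := tp_b T k; have zA := K_A zK.
have EW : seg f 0 m.+1 \subset y |: W i.
  by apply/subsetP=> _ /segP[s sm ->]; case: (fU s).
have yWA : y |: W i \subset A i.
  by rewrite subUset sub1set yA /=; apply: subset_trans (core_sub i); apply: subsetDl.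
have yWC : apart (y |: W i) (C j).
  apply: apartS (apart_A1 ij yA) => //; apply: setUS; exact: subsetDl.
have nea : e != a by apply: (@A_neq i); apply: (subsetP yWA).
have neaa : ~~ adj e a.
  rewrite adj_sym; move: eW; rewrite in_setU1 => /predU1P[->|]; first exact: (K_nadj yK).
  exact: W_nadj.
have eD s : s <= l -> e != d s.
  move=> sl; have [_] := fU m (leqnn m); apply: contraNneq; rewrite -/e => ->; exact: mem_seg.
(* The end [d l] sees [a], so its only other neighbour is [d l.-1], which differs from [e]. *)
have j0l : j0 < l.
  rewrite ltn_neqAle; case/andP: ij0 => _ ->; rewrite andbT; apply/negP=> /eqP jl.
  case: dl => _ _ _ al _; have lp : l.-1 <= l by nlia.
  have le : e = d l.-1.
    apply: (pendant al) => //; last exact: leg_neq_a.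
      by rewrite -{1}jl adj_sym.
    by rewrite leg_adj //; nlia.
  by have := eD _ lp; rewrite le eqxx.
have sepE s r : s <= l -> (s < i0 \/ j0 < s) -> r <= m ->
    (f r != d s) && ~~ adj (f r) (d s).
  move=> sl hs rm; have [_ rD] := fU r rm.
  have -> : f r != d s by apply: contraNneq rD => ->; exact: mem_seg.
  move: rm; rewrite leq_eqVlt => /predU1P[->|rm]; last by apply: fsep => //; exact: mem_seg.
  by apply/negP=> /(ext s sl); nlia.
have sepE' s r : s <= l -> r < m -> (f r != d s) && ~~ adj (f r) (d s).
  move=> sl rm; have [_ rD] := fU r (ltnW rm).
  have -> : f r != d s by apply: contraNneq rD => ->; exact: mem_seg.
  by apply: fsep => //; exact: mem_seg.
have kj : apart (z |: C k) (C j) by apply: apart_A1; rewrite // eq_sym.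
have legz s t : t <= l.+1 -> apart (seg d s t) (z |: C k).
  move=> tl; apply: apartS leg_apart.
    by apply/subsetP=> _ /segP[r rt ->]; apply: mem_seg; nlia.
  by rewrite subUset sub1set zA core_sub.
have jleg s : 0 < s -> apart (C j) (seg d s l.+1).
  by move=> s0'; apply: apart_sym; apply: apartS (leg_apart1 s0') => //; apply: core_sub.
have linkEz r (U : {set G}) : r <= m -> seg f 0 r.+1 \subset U -> z |: C k \subset U -> exists n,
    adj n a /\ linked U (f r) n.
  move=> rm sU zU; have [n [nC na zn]] := core_term zA; exists n; split=> //.
  apply: (@linked_trans _ _ y).
    rewrite linked_sym -f0; apply: (ipath_link fp) => // q qr.
    by apply: (subsetP sU); apply: mem_seg; nlia.
  apply: (@linked_trans _ _ z); last exact: linkedS zn.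
  apply: linked1.
  - by apply: (subsetP sU); rewrite -f0 mem_seg.
  - by apply: (subsetP zU); rewrite setU11.
  - by rewrite (tp_adj T ik yA zA) yK.
(* A single neighbour makes [d i0] the end of a theta, a gap makes [e] the end; two consecutive
   neighbours form the wanted triangle. *)
have [eij|[jS|gap]] : i0 = j0 \/ (j0 = i0.+1 \/ i0.+1 < j0) by nlia.
- exfalso; subst j0; have il : i0 <= l := ltnW j0l.
  have v2 : via (seg f 0 m.+1 :|: (z |: C k)) (d i0) a.
    have [||n [na en]] := @linkEz m (seg f 0 m.+1 :|: (z |: C k)) (leqnn m).
    + exact: subsetUl.
    + exact: subsetUr.
    exists e, n; split=> //; first by rewrite inE mem_seg //=.
    by rewrite adj_sym.
  have v3 : via (seg d i0.+1 l.+1) (d i0) a.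
    by apply: leg_tail_via; rewrite ?leg_adj ?eqxx //; nlia.
  have na : ~~ adj (d i0) a by rewrite leg_a //; nlia.
  apply: (theta_via free (leg_neq_a il) na (leg_head_via il) v2 v3).
  + apply: apartU; apply: apartUr.
    * apply: apart_sym => _ _ /segP[r rm ->] /segP[s sl ->]; apply: sepE; nlia.
    * by apply: legz; nlia.
    * by apply: apart_sym; apply: apartS EW _ yWC.
    * exact: apart_sym.
  + by apply: apartU; [apply: leg_split | apply: jleg]; nlia.
  + apply: apartU; last by apply: apart_sym; apply: legz.
    by move=> _ _ /segP[r rm ->] /segP[s sl ->]; apply: sepE; nlia.
- exists i0, e, (seg f 0 m.+1); subst j0; split=> //; first nlia.
    split=> //; first by rewrite mem_seg //=.
      by rewrite -f0 mem_seg.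
    rewrite linked_sym -f0; apply: (ipath_link fp) => // q qr.
    by apply: mem_seg; nlia.
  move=> _ s /segP[r rm ->] sl; have [_ rD] := fU r rm.
  split; first by apply: contraNneq rD => ->; exact: mem_seg.
  move: rm; rewrite /= ltnS leq_eqVlt => /predU1P[->|rm].
    by move=> /(ext s sl); split=> //; nlia.
  by have /andP[_ /negPf->] := sepE' s r sl rm.
exfalso.
have v1 : via (seg d 0 i0.+1 :|: C j) e a.
  have il : i0 <= l by nlia.
  have [q [n [qC dq qn na]]] := leg_head_via il.
  have sub : seg d 0 i0 :|: C j \subset seg d 0 i0.+1 :|: C j.
    by apply: setSU; apply/subsetP=> _ /segP[s si ->]; apply: mem_seg; nlia.
  exists (d i0), n; split=> //; first by rewrite inE mem_seg //=.
  apply: (@linked_trans _ _ q); last exact: linkedS sub qn.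
  apply: linked1 => //; last exact: (subsetP sub).
  by rewrite inE mem_seg //=.
have v2 : via (seg f 0 m :|: (z |: C k)) e a.
  (* For [m = 0] the vertex [e] is [y] itself, and the branch starts at [z]. *)
  have [m0|m0] := posnP m.
    have ez : adj e z by rewrite /e m0 f0 (tp_adj T ik yA zA) yK.
    have [q [n [qC zq qn na]]] := via_A zA ez.
    exists q, n; split=> //; first by rewrite inE qC orbT.
    by apply: linkedS qn; apply: subsetUr.
  have m1 : m.-1 <= m by nlia.
  have [||n [na en]] := @linkEz m.-1 (seg f 0 m :|: (z |: C k)) m1.
  - by rewrite prednK // subsetUl.
  - exact: subsetUr.
  exists (f m.-1), n; split=> //.
    by rewrite inE mem_seg //; nlia.
  by have [_ ->] := fp m m.-1 (leqnn m) m1; rewrite prednK // eqxx orbT.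
have jl : j0 <= l by nlia.
apply: (theta_via free nea neaa v1 v2 (leg_tail_via jl ej)).
- apply: apartU; apply: apartUr.
  + by apply: apart_sym => _ _ /segP[r rm ->] /segP[s sl ->]; apply: sepE'; nlia.
  + by apply: legz; nlia.
  + apply: apart_sym; apply: apartS _ _ yWC => //; apply: subset_trans EW.
    by apply/subsetP=> _ /segP[r rm ->]; apply: mem_seg; nlia.
  + exact: apart_sym.
- by apply: apartU; [apply: leg_split | apply: jleg]; nlia.
apply: apartU; last by apply: apart_sym; apply: legz.
by move=> _ _ /segP[r rm ->] /segP[s sl ->]; apply: sepE'; nlia.
Qed.

End Leg.

Lemma apart_edge (u v : G) (P : Prop) : (u != v) && ~~ adj u v -> u != v /\ (adj u v -> P).
Proof. by case/andP=> -> /negPf->. Qed.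

Lemma apart_edge_sym (u v : G) (P : Prop) : (v != u) && ~~ adj v u -> u != v /\ (adj u v -> P).
Proof. by rewrite eq_sym adj_sym; apply: apart_edge. Qed.

Let memE := (in_setU, in_setU1, in_set1).

(** * How interface vertices attach to a jewel and its legs *)

Section JewelHit.
Variables (i j k : 'I_3) (p : G).
Hypotheses (ij : i != j) (ik : i != k) (jk : j != k) (jp : jewel i j k p).

(** Two sides of a prism: the heads of the two legs are joined at their common start [p], the tails
    through [a], and only the two edges at which the legs are cut run between them. *)
Lemma only_edges_legs d d' l l' m m' : leg i p d l -> leg j p d' l' -> m < l -> m' < l' ->
  only_edges (seg d 0 m.+1 :|: seg d' 0 m'.+1)
    (a |: (seg d m.+1 l.+1 :|: seg d' m'.+1 l'.+1)) (d m) (d m.+1) (d' m') (d' m'.+1).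
Proof.
move=> dl dl' ml ml'; have jp' := jewel_sym jp.
have d0 : d 0 = d' 0 by case: dl dl' => _ -> _ _ _ [_ -> _ _ _].
have cross s s' : 0 < s <= l -> 0 < s' <= l' -> (d s != d' s') && ~~ adj (d s) (d' s').
  move=> sl sl'; apply: (apart_core ij); first exact: (leg_core dl sl).
  by apply: core_A; apply: (leg_core dl' sl').
move=> u v; rewrite in_setU in_setU1 in_setU.
case/orP=> /segP[s sm ->] => /predU1P[->|/orP[]/segP[r rm ->]].
- have sl : s <= l by nlia.
  by rewrite (leg_neq_a jp dl) // (leg_a jp dl) //; split=> //; nlia.
- have sl : s <= l by [nlia]; have rl : r <= l by nlia.
  rewrite (leg_eq dl) // (leg_adj dl) //; split; first nlia.
  by move=> h; left; have [-> ->] : s = m /\ r = m.+1 by nlia.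
- case: s sm => [|s] sm; last by apply: apart_edge; apply: cross; nlia.
  have rl : r <= l' by nlia.
  rewrite d0 (leg_eq dl') // (leg_adj dl') //; split; first nlia.
  by move=> h; right; have [-> ->] : 0 = m' /\ r = m'.+1 by nlia.
- have sl : s <= l' by nlia.
  by rewrite (leg_neq_a jp' dl') // (leg_a jp' dl') //; split=> //; nlia.
- case: s sm => [|s] sm; last by apply: apart_edge_sym; apply: cross; nlia.
  have rl : r <= l by nlia.
  rewrite -d0 (leg_eq dl) // (leg_adj dl) //; split; first nlia.
  by move=> h; left; have [-> ->] : 0 = m /\ r = m.+1 by nlia.
have sl : s <= l' by [nlia]; have rl : r <= l' by nlia.
rewrite (leg_eq dl') // (leg_adj dl') //; split; first nlia.
by move=> h; right; have [-> ->] : s = m' /\ r = m'.+1 by nlia.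
Qed.

(** The triangles that [leg_triangle] finds on a leg of each core are joined through [p], through
    the interfaces and through [a]. This prism is avoided only if both triangles contain [p], and
    then another prism forces [e = y]. *)
Lemma jewel_leg_hit d l y : leg i p d l -> y \in K i -> forall s, s <= l -> adj y (d s) = (s < 2).
Proof.
move=> dl yK; have jp' := jewel_sym jp; have ji : j != i by rewrite eq_sym.
have [d' [l' dl']] := leg_exists jp'.
have [y' yK'] := tp_b T j; have [z zK] := tp_b T k.
have yA := K_A yK; have yA' := K_A yK'; have zA := K_A zK.
have [m [e [E [ml [eE yE Eey EW] em em1 Ed]]]] := leg_triangle ij ik jk jp dl yK.
have [m' [e' [E' [ml' [eE' yE' Eey' EW']] em' em1' Ed']]] :=
  leg_triangle ji jk ik jp' dl' yK'.
have WA i' x : x \in K i' -> x |: W i' \subset A i'.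
  move=> xK; rewrite subUset sub1set (K_A xK) /=.
  by apply: subset_trans (core_sub i'); apply: subsetDl.
have EA := subset_trans EW (WA _ _ yK); have EA' := subset_trans EW' (WA _ _ yK').
have Ea u : u \in E -> u != a /\ ~~ adj u a.
  move=> uE; split; first by apply: (@A_neq i); apply: (subsetP EA).
  rewrite adj_sym; have := subsetP EW u uE; rewrite in_setU1 => /predU1P[->|].
    exact: (K_nadj yK).
  exact: W_nadj.
have Ea' u : u \in E' -> u != a /\ ~~ adj u a.
  move=> uE; split; first by apply: (@A_neq j); apply: (subsetP EA').
  rewrite adj_sym; have := subsetP EW' u uE; rewrite in_setU1 => /predU1P[->|].
    exact: (K_nadj yK').
  exact: W_nadj.
have EWK u : u \in E -> u != y -> u \in C i.
  by move=> /(subsetP EW); rewrite in_setU1 => /predU1P[->|/W_core //]; rewrite eqxx.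
have EWK' u : u \in E' -> u != y' -> u \in C j.
  by move=> /(subsetP EW'); rewrite in_setU1 => /predU1P[->|/W_core //]; rewrite eqxx.
have yy' : adj y y' by rewrite (tp_adj T ij yA yA') yK.
have [_ d0 _ _ _] := dl; have [_ d0' _ _ _] := dl'.
have EdE s u : u \in E -> 0 < s <= l' -> (u != d' s) && ~~ adj u (d' s).
  move=> uE sl; have := apart_core ji (leg_core dl' sl) (subsetP EA _ uE).
  by rewrite eq_sym adj_sym.
have EdE' s u : u \in E' -> 0 < s <= l -> (u != d s) && ~~ adj u (d s).
  move=> uE sl; have := apart_core ij (leg_core dl sl) (subsetP EA' _ uE).
  by rewrite eq_sym adj_sym.
have EE u v : u \in E -> v \in E' -> u != v /\ (adj u v -> u = y /\ v = y').
  move=> uE vE; have uA := subsetP EA _ uE; have vA := subsetP EA' _ vE; split.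
    by apply: contraTneq vA => <-; apply: (tp_disj T ij uA).
  rewrite (tp_adj T ij uA vA) => /andP[uK vK]; split; apply/eqP; apply/negPn/negP=> ne.
    by move: (core_K (EWK _ uE ne)); rewrite uK.
  by move: (core_K (EWK' _ vE ne)); rewrite vK.
(* With both indices zero the two triangles share [p] and cannot bound a prism. *)
have [mm0|] : (m = 0 /\ m' = 0) \/ ~~ ((m == 0) && (m' == 0)).
- by case: (m) => [|?]; case: (m') => [|?]; [left | right | right | right].
- case: mm0 => m0 m0'; subst m m'.
  have ey : e = y.
    apply/eqP/negPn/negP=> ney.
    (* One triangle is at [p], the other is formed by [y'], [z], [y] from the three interfaces. The
       sides run from [p] through [E'], along the leg to [a] and back to [z], and through [E], which
       is nontrivial as [e] differs from [y]. *)
    apply: (@no_prism _ p (d 1) e y' z y ([set p] :|: E')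
      (seg d 1 l.+1 :|: (a |: (z |: C k))) E free).
    + by split; rewrite -?d0 1?adj_sym // (leg_adj dl) //; nlia.
    + split; rewrite 1?adj_sym // ?(tp_adj T ik yA zA) ?yK // adj_sym.
      by rewrite (tp_adj T jk yA' zA) yK'.
    + split=> //.
      * by have := jp => -[_ pA _ _ _]; apply: contraNneq (pA j) => ->.
      * have d1C := leg_core dl (s := 1) ml.
        by apply: contraTneq zA => <-; apply: (tp_disj T ik (core_A d1C)).
    + by split; rewrite ?in_setU ?set11 // mem_seg // nlia.
    + split=> //.
      * apply: (@linked_trans _ _ e').
          apply: linked1; rewrite ?memE ?eqxx ?eE' ?orbT //.
          by rewrite -d0' adj_sym.
        by apply: linkedS Eey'; apply: subsetUr.
      * have [n [nC na zn]] := core_term zA; have [_ _ _ al _] := dl.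
        apply: (@linked_trans _ _ (d l)).
          apply: (leg_link dl) => // s sl; by rewrite memE mem_seg.
        apply: (@linked_trans _ _ a).
          apply: linked1; rewrite ?memE ?eqxx ?orTb ?orbT //; last by rewrite adj_sym.
          by rewrite mem_seg //; nlia.
        apply: (@linked_trans _ _ n); last first.
          rewrite linked_sym; apply: linkedS zn; apply: subset_trans (subsetUr _ _).
          exact: subsetUr.
        have nU : n \in z |: C k by rewrite setU1r.
        apply: linked1; [| |by rewrite adj_sym].
          by rewrite in_setU setU11 orbT.
        by rewrite in_setU (in_setU1 _ a) nU !orbT.
    + move=> u v; rewrite in_setU in_set1 => uQ.
      rewrite in_setU in_setU1 => /orP[/segP[s sl ->]|/predU1P[->|vz]].
      * case/orP: uQ => [/eqP->|uE'].
          have sl' : s <= l by nlia.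
          rewrite -d0 (leg_eq dl) // (leg_adj dl) //; split; first nlia.
          by move=> h; left; have -> : s = 1 by nlia.
        by apply: apart_edge; apply: (EdE' _ _ uE'); nlia.
      * apply: apart_edge; case/orP: uQ => [/eqP->|/Ea' []->->//].
        by have := jp => -[pa pA _ _ _]; rewrite pa out_nadj.
      * case/orP: uQ => [/eqP->|uE'].
          apply: apart_edge; have := jp => -[pa pA _ _ pk].
          have vA : v \in A k by move: vz; rewrite in_setU1 => /predU1P[->//|/core_A].
          rewrite pk // andbT; by apply: contraNneq (pA k) => ->.
        move: vz; rewrite in_setU1 => /predU1P[->|vC]; last first.
          have kj : k != j by rewrite eq_sym.
          by apply: apart_edge_sym; apply: (apart_core kj vC (subsetP EA' _ uE')).
        have uA := subsetP EA' _ uE'; split.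
          by apply: contraTneq zA => <-; apply: (tp_disj T jk uA).
        rewrite (tp_adj T jk uA zA) => /andP[uK _]; right; split=> //.
        apply/eqP; apply/negPn/negP=> ne.
        by move: (core_K (EWK' _ uE' ne)); rewrite uK.
    + move=> u v; rewrite in_setU in_set1 => /orP[/eqP->|uE] vE.
        have [ne h] := Ed v 0 vE (leq0n l); rewrite -d0 eq_sym adj_sym.
        by split=> // /h[-> _]; left.
      have [ne h] := EE v u vE uE; rewrite eq_sym adj_sym.
      by split=> // /h[-> ->]; right.
    move=> u v; rewrite in_setU in_setU1 => /orP[/segP[s sl ->]|/predU1P[->|uz]] vE.
    + have sl' : s <= l by nlia.
      have [ne h] := Ed v s vE sl'; rewrite eq_sym adj_sym; split=> // /h[-> hs]; left.
      by have -> : s = 1 by nlia.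
    + by apply: apart_edge_sym; case: (Ea v vE) => -> ->.
    move: uz; rewrite in_setU1 => /predU1P[->|uC]; last first.
      have ki : k != i by rewrite eq_sym.
      by apply: apart_edge; apply: (apart_core ki uC (subsetP EA _ vE)).
    have vA := subsetP EA _ vE; rewrite eq_sym adj_sym; split.
      by apply: contraTneq zA => <-; apply: (tp_disj T ik vA).
    rewrite (tp_adj T ik vA zA) => /andP[vK _]; right; split=> //.
    apply/eqP; apply/negPn/negP=> ne.
    by move: (core_K (EWK _ vE ne)); rewrite vK.
  subst e; move=> s sl; apply/idP/idP.
    by have [_ h] := Ed y s yE sl; move=> /h[_]; nlia.
  by case: s sl => [|[|]].
move=> mm0 s sl; exfalso.
(* Sides: the two heads through [p], the connections [E] and [E'] through the edge [y y'], and the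
   two tails through [a]. *)
apply: (@no_prism _ (d m) e (d m.+1) (d' m') e' (d' m'.+1)
   (seg d 0 m.+1 :|: seg d' 0 m'.+1) (E :|: E')
   (a |: (seg d m.+1 l.+1 :|: seg d' m'.+1 l'.+1)) free).
- by split=> //; [rewrite adj_sym | rewrite (leg_adj dl) ?eqxx // ltnW].
- by split=> //; [rewrite adj_sym | rewrite (leg_adj dl') ?eqxx // ltnW].
- have cross r r' : 0 < r <= l -> 0 < r' <= l' -> d r != d' r'.
    move=> rl rl'; have := apart_core ij (leg_core dl rl) (core_A (leg_core dl' rl')).
    by case/andP.
  split.
  + move: mm0 ml ml'; case: (m) (m') => [|r] [|r'] //= _ ml ml'.
    * by rewrite d0 -d0' (leg_eq dl') // ltnW.
    * by rewrite d0' -d0 (leg_eq dl) // ltnW.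
    by apply: cross; nlia.
  + by case: (EE e e' eE eE').
  + by apply: cross; nlia.
- by split; rewrite ?in_setU ?in_setU1 ?eE ?mem_seg ?orbT //=; nlia.
- split.
  + apply: (@linked_trans _ _ p); [rewrite linked_sym -d0 | rewrite -d0'].
      by apply: (leg_link dl) => [||r rm]; rewrite ?memE ?mem_seg //; nlia.
    by apply: (leg_link dl') => [||r rm]; rewrite ?memE ?mem_seg ?orbT //; nlia.
  + apply: (@linked_trans _ _ y); first by apply: linkedS Eey; apply: subsetUl.
    apply: (@linked_trans _ _ y'); first by apply: linked1; rewrite // memE ?yE ?yE' ?orbT.
    by rewrite linked_sym; apply: linkedS Eey'; apply: subsetUr.
  + have [_ _ _ al _] := dl; have [_ _ _ al' _] := dl'.
    apply: (@linked_trans _ _ (d l)).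
      by apply: (leg_link dl) => // r rm; rewrite in_setU1 in_setU mem_seg ?orbT //; nlia.
    apply: (@linked_trans _ _ a).
      apply: linked1; rewrite ?memE ?eqxx //; last by rewrite adj_sym.
      by rewrite mem_seg ?orbT //; nlia.
    apply: (@linked_trans _ _ (d' l')).
      apply: linked1; rewrite ?memE ?eqxx //.
      by rewrite mem_seg ?orbT //; nlia.
    rewrite linked_sym; apply: (leg_link dl') => // r rm.
    by rewrite in_setU1 in_setU mem_seg ?orbT //; nlia.
- move=> u v; rewrite !in_setU => /orP[]/segP[r rm ->] /orP[] vE.
  + have rl : r <= l by nlia.
    have [ne h] := Ed v r vE rl; rewrite eq_sym adj_sym; split=> // /h[-> hr]; left.
    by have -> : r = m by nlia.
  + case: r rm => [|r] rm; last by apply: apart_edge_sym; apply: EdE' => //; nlia.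
    have [ne h] := Ed' v 0 vE (leq0n l'); rewrite d0 -d0' eq_sym adj_sym; split=> // /h[-> hr].
    by right; have <- : 0 = m' by nlia.
  + case: r rm => [|r] rm; last by apply: apart_edge_sym; apply: EdE => //; nlia.
    have [ne h] := Ed v 0 vE (leq0n l); rewrite d0' -d0 eq_sym adj_sym; split=> // /h[-> hr].
    by left; have <- : 0 = m by nlia.
  + have rl : r <= l' by nlia.
    have [ne h] := Ed' v r vE rl; rewrite eq_sym adj_sym; split=> // /h[-> hr]; right.
    by have -> : r = m' by nlia.
- exact: only_edges_legs.
move=> u v; rewrite in_setU in_setU1 in_setU => /orP[] uE /predU1P[->|/orP[]/segP[r rm ->]].
+ by apply: apart_edge; case: (Ea u uE) => -> ->.
+ have rl : r <= l by nlia.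
  have [ne h] := Ed u r uE rl; split=> // /h[-> hr]; left.
  by have -> : r = m.+1 by nlia.
+ by apply: apart_edge; apply: EdE => //; nlia.
+ by apply: apart_edge; case: (Ea' u uE) => -> ->.
+ by apply: apart_edge; apply: EdE' => //; nlia.
have rl : r <= l' by nlia.
have [ne h] := Ed' u r uE rl; split=> // /h[-> hr]; right.
by have -> : r = m'.+1 by nlia.
Qed.

Lemma jewel_K y : y \in K i -> adj p y.
Proof.
move=> yK; have [d [l dl]] := leg_exists jp.
by have := jewel_leg_hit dl yK (leq0n l); have [_ -> _ _ _] := dl; rewrite adj_sym.
Qed.

End JewelHit.

(** * Nonadjacent jewels of the same kind *)

Section JewelPairs.
Variables (i j k : 'I_3).
Hypotheses (ij : i != j) (ik : i != k) (jk : j != k).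

(** Turns a path from [q] that attaches to a leg of [p] into a leg of [q], to which [jewel_leg_hit]
    can then be applied. Position [m.+1] of the new leg is [d r0]. *)
Lemma leg_concat p q f m d l r0 : ipath f m -> f 0 = q -> (forall s, 0 < s <= m -> f s \in W i) ->
  leg i p d l -> 0 < r0 <= l -> adj (f m) (d r0) ->
  (forall s r, s <= m -> r0 <= r <= l -> f s != d r /\ (adj (f s) (d r) -> s = m /\ r = r0)) ->
  leg i q (fun s => if s <= m then f s else d (r0 + (s - m.+1))) (m.+1 + (l - r0)).
Proof.
move=> fm f0 fW dl /andP[r00 r0l] fr fd; have [_ _ lC al dW] := dl.
have end_l : r0 + (m.+1 + (l - r0) - m.+1) = l by nlia.
have mlt : (m.+1 + (l - r0) <= m) = false by nlia.
split; rewrite ?mlt ?end_l //; last first.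
  move=> s sl; case: ifP => sm; first by apply: fW; nlia.
  by apply: dW; nlia.
move=> s t sl tl; case: ifP => sm; case: ifP => tm.
- exact: fm.
- have [|ne h] := fd s (r0 + (t - m.+1)) sm; first by nlia.
  split; first by rewrite (negPf ne); nlia.
  apply/idP/idP=> [/h|]; first by nlia.
  move=> st; have [-> ->] : s = m /\ t = m.+1 by nlia.
  by rewrite subnn addn0.
- have [|ne h] := fd t (r0 + (s - m.+1)) tm; first by nlia.
  split; first by rewrite eq_sym (negPf ne); nlia.
  rewrite adj_sym; apply/idP/idP=> [/h|]; first by nlia.
  move=> st; have [-> ->] : t = m /\ s = m.+1 by nlia.
  by rewrite subnn addn0.
have sl' : r0 + (s - m.+1) <= l by [nlia]; have tl' : r0 + (t - m.+1) <= l by nlia.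
by rewrite (leg_eq dl) // (leg_adj dl) //; split; nlia.
Qed.

Lemma jewel_apart p : jewel i j k p -> apart [set p] (A k).
Proof.
case=> pa pA _ _ pk u v /set1P-> vk; rewrite pk // andbT.
by apply: contraNneq (pA k) => ->.
Qed.

(** For thetas ending in an interface vertex rather than in [a]: this branch follows the leg to [a]
    and returns through the third part. *)
Lemma tail_via_K p d l r y z c : leg i p d l -> r <= l -> y \in K j -> z \in K k ->
  adj c (d r) -> via (seg d r l.+1 :|: (a |: (z |: C k))) c y.
Proof.
move=> dl rl yK zK cd; have [_ _ lC al _] := dl.
have [n [nC na zn]] := core_term (K_A zK).
exists (d r), z; split=> //.
- by rewrite in_setU mem_seg //; nlia.
- apply: (@linked_trans _ _ (d l)).
    by apply: (leg_link dl) => // s sl; rewrite in_setU mem_seg.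
  apply: (@linked_trans _ _ a).
    apply: linked1; rewrite ?in_setU ?in_set1 ?eqxx ?orbT //; last by rewrite adj_sym.
    by rewrite mem_seg // rl /=.
  apply: (@linked_trans _ _ n).
    apply: linked1; rewrite ?in_setU ?in_set1 ?eqxx ?orbT ?nC ?orbT //; by rewrite adj_sym.
  rewrite linked_sym; apply: linkedS zn; apply: subset_trans (subsetUr _ _).
  exact: subsetUr.
by rewrite adj_sym (tp_adj T jk (K_A yK) (K_A zK)) yK.
Qed.

Lemma tail_apart (Q : {set G}) p d l r z : jewel i j k p -> leg i p d l -> z \in K k ->
  apart Q (seg d r l.+1) -> (forall u, u \in Q -> u != a /\ ~~ adj u a) ->
  apart Q (A k) -> apart Q (seg d r l.+1 :|: (a |: (z |: C k))).
Proof.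
move=> jp dl zK s1 s2 s3; apply: apartUr => //; apply: apartUr.
  by move=> u _ uQ /set1P->; have [-> ->] := s2 u uQ.
by apply: apartS s3 => //; rewrite subUset sub1set (K_A zK) core_sub.
Qed.

(** The last neighbour of [p'] on the leg starts a leg of [p']. Interface vertices see exactly the
    first two vertices of any leg, so [d 1] is the only neighbour. Then [d 1] and a vertex of [K j]
    are the ends of a theta through [p], [p'] and the tail of the leg. *)
Lemma jewel_no_hit p p' d l : jewel i j k p -> jewel i j k p' -> p != p' -> ~~ adj p p' ->
  leg i p d l -> forall s, s <= l -> ~~ adj p' (d s).
Proof.
move=> jp jp' pp' npp' dl s sl; apply/negP=> ps.
have [i0 [j0 [pi pj ij0 ext]]] := @extreme_indices (fun s => adj p' (d s)) l s sl ps.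
have [_ d0 lC al dW] := dl; have l1 := leg_gt1 jp dl.
have [pa pA _ _ pk] := jp; have [pa' pA' _ _ pk'] := jp'.
have i00 : 0 < i0 by case: (i0) pi => // ; rewrite d0 adj_sym (negPf npp').
have pd r : r <= l -> p' != d r.
  case: r => [|r] rl; first by rewrite d0 eq_sym.
  by apply: contraNneq (pA' i) => ->; apply: core_A; apply: (leg_core dl).
have [y yK] := tp_b T i; have [y' yK'] := tp_b T j; have [z zK] := tp_b T k.
(* The attached path is the single vertex [p'], given as a constant function with [m = 0]. *)
have dl' : leg i p' (fun s => if s <= 0 then p' else d (j0 + (s - 1))) (1 + (l - j0)).
  apply: (@leg_concat p p' (fun=> p') 0 d l j0) => //.
  - by case=> [|?] [|?] //; rewrite !eqxx adj_irrefl.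
  - by move=> ?; nlia.
  - by nlia.
  move=> s' r s0 rl; have rl' : r <= l by nlia.
  by split; [apply: pd | move=> /(ext r rl'); nlia].
have := jewel_leg_hit ij ik jk jp' dl' yK (s := 1) isT; rewrite /= addn0.
rewrite (jewel_leg_hit ij ik jk jp dl yK); last by nlia.
move=> j1; have {}j1 : j0 = 1 by nlia.
have i1 : i0 = 1 by nlia.
subst i0 j0; have d1C := leg_core dl (s := 1) (ltnW l1).
have ji : j != i by rewrite eq_sym.
have py' q : jewel i j k q -> adj q y'.
  by move=> jq; apply: (jewel_K ji jk ik (jewel_sym jq) yK').
have ap := apart_core ij d1C (K_A yK').
have [cy ncy] := andP ap.
have v1 q : jewel i j k q -> adj (d 1) q -> via [set q] (d 1) y'.
  by move=> jq dq; exists q, q; rewrite set11 dq linked_refl py'.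
have v3 : via (seg d 2 l.+1 :|: (a |: (z |: C k))) (d 1) y'.
  by apply: (tail_via_K dl) => //; rewrite (leg_adj dl) // ltnW.
have dp : adj (d 1) p by rewrite -d0 (leg_adj dl) // ltnW.
have dp' : adj (d 1) p' by rewrite adj_sym.
apply: (theta_via free cy ncy (v1 p jp dp) (v1 p' jp' dp') v3).
- by move=> _ _ /set1P-> /set1P->; rewrite pp'.
- apply: (tail_apart jp dl zK).
  + move=> _ _ /set1P-> /segP[r rl ->]; have rl' : r <= l by nlia.
    by rewrite -d0 (leg_eq dl) // (leg_adj dl) //; nlia.
  + by move=> _ /set1P->; rewrite pa out_nadj.
  + exact: jewel_apart.
apply: (tail_apart jp dl zK).
+ move=> _ _ /set1P-> /segP[r rl ->]; have rl' : r <= l by nlia.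
  by rewrite pd //; apply/negP=> /(ext r rl'); nlia.
+ by move=> _ /set1P->; rewrite pa' out_nadj.
+ exact: jewel_apart.
Qed.

(* The triangle at which [R] attaches and the triangle [f 1], [y], [q] form a prism. *)
Lemma leg_side_prism q f l m (R : {set G}) r h y : jewel i j k q -> leg i q f l -> 1 < m < l ->
  y \in K i -> R \subset W i -> r \in R -> linked R r h -> h \in R -> adj h y ->
  adj r (f m) -> adj r (f m.+1) ->
  (forall u s, u \in R -> s <= l -> u != f s /\ (adj u (f s) -> u = r /\ (s = m \/ s = m.+1))) ->
  False.
Proof.
move=> jq fl /andP[m1 ml] yK RW rR Rrh hR hy rm rm1 Rf.
have [_ f0 lC al fW] := fl; have [qa qA _ [u uC qu] _] := jq.
have yhit := jewel_leg_hit ij ik jk jq fl yK.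
have yA := K_A yK.
have RC x : x \in R -> x \in C i by move=> /(subsetP RW)/W_core.
have cross x v : x \in y |: R -> v \in C j -> (x != v) && ~~ adj x v.
  move=> xR vC; have xA : x \in A i.
    by move: xR; rewrite in_setU1 => /predU1P[->|/RC/core_A].
  have ji : j != i by rewrite eq_sym.
  by have := apart_core ji vC xA; rewrite eq_sym adj_sym.
(* Sides: back along the leg to [f 1]; through [R] to [y]; on along the leg to [a] and back through
   the core of [j] to [q]. The bound [1 < m] keeps the triangles disjoint. *)
apply: (@no_prism _ (f m) r (f m.+1) (f 1) y q (seg f 1 m.+1) (y |: R)
  (a |: (seg f m.+1 l.+1 :|: (q |: C j))) free).
- split; rewrite 1?adj_sym //; last by rewrite adj_sym.
  by rewrite (leg_adj fl) //; nlia.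
- split; [by rewrite adj_sym yhit //; nlia | by rewrite -f0 (leg_adj fl) //; nlia |].
  by rewrite -f0 yhit.
- split.
  + by rewrite (leg_eq fl) //; nlia.
  + by apply: contraTneq yK => <-; apply: core_K; apply: RC.
  + by rewrite -f0 (leg_eq fl).
- by split; rewrite ?in_setU ?rR ?mem_seg ?orbT //; nlia.
- split.
  + rewrite linked_sym; apply: (leg_link fl); [nlia | nlia |].
    by move=> s sm; rewrite mem_seg.
  + apply: (@linked_trans _ _ h); first by apply: linkedS Rrh; apply: subsetUr.
    by apply: linked1; rewrite ?in_setU1 ?eqxx ?hR ?orbT.
  + have [n [nC na un]] := core_term (core_A uC).
    apply: (@linked_trans _ _ (f l)).
      by apply: (leg_link fl) => // s sl; rewrite in_setU1 in_setU mem_seg ?orbT //; nlia.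
    apply: (@linked_trans _ _ a).
      apply: linked1; rewrite ?in_setU1 ?in_setU ?eqxx //; last by rewrite adj_sym.
      by rewrite mem_seg ?orbT //; nlia.
    apply: (@linked_trans _ _ n).
      by apply: linked1; rewrite ?in_setU1 ?in_setU ?in_setU1 ?eqxx ?nC ?orbT // adj_sym.
    apply: (@linked_trans _ _ u).
      rewrite linked_sym; move: un; rewrite (setUidPr _) ?sub1set //; apply: linkedS.
      by rewrite !setUA subsetUr.
    by apply: linked1; rewrite ?memE ?eqxx ?uC ?orTb ?orbT // adj_sym.
- move=> x v /segP[s sm ->]; have sl : s <= l by nlia.
  rewrite in_setU1 => /predU1P[->|vR].
    split; first by apply: contraTneq yK => <-; apply: core_K; apply: (leg_core fl); nlia.
    by rewrite adj_sym yhit // => s2; right; have -> : s = 1 by nlia.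
  have [ne h1] := Rf v s vR sl; rewrite eq_sym adj_sym; split=> // /h1[-> hs]; left.
  by have -> : s = m by nlia.
- move=> x v /segP[s sm ->]; have sl : s <= l by nlia.
  rewrite in_setU1 in_setU in_setU1 => /predU1P[->|/orP[/segP[t tm ->]|/predU1P[->|vC]]].
  + by apply: apart_edge; rewrite (leg_neq_a jq fl) // (leg_a jq fl) //; nlia.
  + have tl : t <= l by nlia.
    rewrite (leg_eq fl) // (leg_adj fl) //; split; first by nlia.
    by move=> st; left; have [-> ->] : s = m /\ t = m.+1 by nlia.
  + rewrite -f0 (leg_eq fl) // (leg_adj fl) //; split; first by nlia.
    by move=> st; right; have -> : s = 1 by nlia.
  apply: apart_edge; apply: (apart_core ij _ (core_A vC)); apply: (leg_core fl); nlia.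
move=> x v xQ.
rewrite in_setU1 in_setU in_setU1 => /predU1P[->|/orP[/segP[t tm ->]|/predU1P[->|vC]]].
- apply: apart_edge; rewrite (adj_sym x); move: xQ; rewrite in_setU1 => /predU1P[->|xR].
    by rewrite (A_neq yA) (K_nadj yK).
  by rewrite (A_neq (core_A (RC _ xR))) (W_nadj (subsetP RW _ xR)).
- have tl : t <= l by nlia.
  move: xQ; rewrite in_setU1 => /predU1P[->|xR].
    apply: apart_edge; rewrite yhit //; apply/andP; split; last by nlia.
    by apply: contraTneq yK => ->; apply: core_K; apply: (leg_core fl); nlia.
  have [ne h1] := Rf x t xR tl; split=> // /h1[-> ht]; left.
  by have -> : t = m.+1 by nlia.
- move: xQ; rewrite in_setU1 => /predU1P[->|xR].
    split; first by apply: contraTneq yA => ->; exact: qA.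
    by right.
  rewrite -f0; have [ne h1] := Rf x 0 xR (leq0n l); split=> // /h1[_].
  by nlia.
by apply: apart_edge; apply: cross.
Qed.

Lemma jewel_pair_side p p' : jewel i j k p -> jewel i j k p' -> p != p' -> ~~ adj p p' ->
  exists b g c n (L : {set G}),
  [/\ [/\ b \in W i, g \in W i, c \in L & adj n a /\ n \in L],
      [/\ adj p b, ~~ adj p g, adj p' g & ~~ adj p' b],
      [/\ adj b g, adj b c, adj g c & linked L c n],
      L \subset C i &
      forall u, u \in L -> [/\ u != b /\ (adj b u -> u = c), u != g /\ (adj g u -> u = c),
        ~~ adj p u, ~~ adj p' u & adj u a -> u = n]].
Proof.
move=> jp jp' pp' npp'; have [d [l dl]] := leg_exists jp.
have l1 := leg_gt1 jp dl; have [_ d0 lC al dW] := dl.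
have [pa pA _ _ pk] := jp; have [pa' pA' [u0 u0C pu0] _ pk'] := jp'.
have nhit := jewel_no_hit jp jp' pp' npp' dl.
have d1W : d 1 \in W i by apply: dW.
have [y yK] := tp_b T i; have [y' yK'] := tp_b T j; have [z zK] := tp_b T k.
have yhit := jewel_leg_hit ij ik jk jp dl yK.
have ji : j != i by rewrite eq_sym.
have py' q : jewel i j k q -> adj q y'.
  by move=> jq; apply: (jewel_K ji jk ik (jewel_sym jq) yK').
have p'd1 : linked (p' |: W i) p' (d 1).
  have u0W : u0 \in W i.
    rewrite in_setD u0C andbT inE; apply/negP=> au.
    by move: (term_out u0C au (pA' i) pa'); rewrite pu0.
  apply: (@linked_trans _ _ u0); first by apply: linked1; rewrite ?setU11 ?setU1r.
  have := core_link u0C d1W; rewrite (setUidPr _) ?sub1set //.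
  by apply: linkedS; apply: subsetUr.
have p'D : p' \notin seg d 1 l.+1.
  apply/segP=> -[s sl e]; have := pA' i; rewrite e core_A //; exact: (leg_core dl).
have d1D : d 1 \in seg d 1 l.+1 by rewrite mem_seg //= ltnW.
have [f [m [[fp f0] fU [_ /segP[s0 s0l ->] fs0] fsep]]] := approach p'd1 d1D p'D (setU11 _ _).
set e := f m in fs0.
have m0 : 0 < m.
  rewrite lt0n; apply/eqP=> mz; have s0l' : s0 <= l by nlia.
  by move: (nhit s0 s0l'); rewrite -f0 -mz -/e fs0.
have fW s : 0 < s <= m -> f s \in W i.
  move=> sm; have sm' : s <= m by nlia.
  have [] := fU s sm'; rewrite in_setU1 => /predU1P[fs|//] _.
  by have [] := fp s 0 sm' (leq0n m); rewrite f0 fs eqxx; nlia.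
have eW : e \in W i by apply: fW; rewrite m0 /=.
have fD s r : s <= m -> 0 < r <= l -> f s != d r.
  by move=> sm rl; have [_] := fU s sm; apply: contraNneq => ->; exact: mem_seg.
have fsep' s r : s < m -> 0 < r <= l -> ~~ adj (f s) (d r).
  by move=> sm rl; apply: fsep => //; apply: mem_seg.
have s0l' : s0 <= l by nlia.
have Ps0 : (0 < s0) && adj e (d s0) by rewrite fs0 andbT; nlia.
have [i0 [j0 [/andP[i00 ei] /andP[j00 ej] ij0 ext]]] :=
  @extreme_indices (fun s => (0 < s) && adj e (d s)) l s0 s0l' Ps0.
have ext' s : 0 < s <= l -> adj e (d s) -> i0 <= s <= j0.
  by move=> /andP[s1 s2] es; apply: ext; rewrite ?s1.
have fd s r : s <= m -> j0 <= r <= l -> f s != d r /\ (adj (f s) (d r) -> s = m /\ r = j0).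
  move=> sm rl; have rl' : 0 < r <= l by nlia.
  split; first exact: fD.
  move: sm; rewrite leq_eqVlt => /predU1P[->|sm]; last by rewrite (negPf (fsep' s r sm rl')).
  by move=> /(ext' r rl'); nlia.
have j0l' : 0 < j0 <= l by nlia.
have fl' := leg_concat fp f0 fW dl j0l' ej fd.
set d' := (fun s => _) in fl'; set l' := _ + _ in fl'.
have d'f s : s <= m -> d' s = f s by rewrite /d' => ->.
have d'd s : j0 <= s -> d' (m.+1 + (s - j0)) = d s.
  move=> js; rewrite /d' ifF; last by nlia.
  by congr d; nlia.
have pp'' : p' != p by rewrite eq_sym.
have np'p : ~~ adj p' p by rewrite adj_sym.
have nhit' := jewel_no_hit jp' jp pp'' np'p fl'.
have yhit' := jewel_leg_hit ij ik jk jp' fl' yK.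
have pf s : s <= m -> ~~ adj p (f s).
  by move=> sm; rewrite -d'f //; apply: nhit'; rewrite /l'; nlia.
(* The vertex [d j0] has index [m.+1 >= 2] on the leg of [p'], so [y] does not see it; hence it is
   not among the first two vertices of the leg of [p] either. *)
have j02 : 1 < j0.
  have h1 := yhit j0; have h2 := yhit' m.+1.
  have e1 : d' m.+1 = d j0 by rewrite -[m.+1]addn0 -(subnn j0) d'd.
  have m1l : m.+1 <= l' by rewrite /l'; nlia.
  have jl : j0 <= l by nlia.
  by move: (h1 jl) (h2 m1l); rewrite e1 => ->; nlia.
have j0l : j0 < l.
  rewrite ltn_neqAle; case/andP: ij0 => _ ->; rewrite andbT; apply/negP=> /eqP jl.
  have lp : l.-1 <= l by nlia.
  have le : e = d l.-1.
    apply: (pendant al); last exact: (leg_neq_a jp dl).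
    + by rewrite -jl adj_sym.
    + by rewrite (leg_adj dl) //; nlia.
    by apply: A_neq (core_A (W_core eW)).
  have lp' : 0 < l.-1 <= l by nlia.
  by have := fD m _ (leqnn m) lp'; rewrite -/e le eqxx.
have fne s : s <= m -> f s != p.
  case: s => [|s] sm; first by rewrite f0.
  by apply: contraTneq (core_A (W_core (fW s.+1 sm))) => ->; apply: pA.
have fseg_d s t : s <= m -> t <= l -> (t < i0 \/ j0 < t \/ s < m) ->
    (f s != d t) && ~~ adj (f s) (d t).
  move=> sm tl hs; case: t tl hs => [|t] tl hs.
    by rewrite d0 fne // adj_sym pf.
  have tl' : 0 < t.+1 <= l by nlia.
  rewrite fD //=; move: sm hs; rewrite leq_eqVlt => /predU1P[->|sm] hs; last exact: fsep'.
  by apply/negP=> /(ext' _ tl'); nlia.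
have fa s : s <= m -> f s != a /\ ~~ adj (f s) a.
  case: s => [|s] sm; first by rewrite f0 pa' out_nadj.
  have sW := fW s.+1 sm; split; first exact: (A_neq (core_A (W_core sW))).
  by rewrite adj_sym (W_nadj sW).
have fk s : s <= m.+1 -> apart (seg f 0 s) (A k).
  move=> sm _ v /segP[[|t] ts ->] vk; first by rewrite f0 (jewel_apart jp' (set11 _)).
  by apply: (apart_core ik _ vk); apply: W_core; apply: fW; nlia.
have dfk s : s <= l.+1 -> apart (seg d 0 s) (A k).
  move=> sl; apply: apartS (leg_apart ik jp dl) => //.
  by apply/subsetP=> _ /segP[r rl ->]; apply: mem_seg; nlia.
have da s u : s <= l -> u \in seg d 0 s -> u != a /\ ~~ adj u a.
  move=> sl /segP[r rl ->]; have rl' : r <= l by nlia.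
  by rewrite (leg_neq_a jp dl) // (leg_a jp dl) //; split=> //; nlia.
have headv r x : r <= l -> adj x (d r) -> via (seg d 0 r.+1) x y'.
  move=> rl xr; exists (d r), p; split=> //; last exact: py'.
  - by apply: mem_seg; nlia.
  - rewrite linked_sym -d0; apply: (leg_link dl) => // s sr.
    by apply: mem_seg; nlia.
have fall r s : r <= m -> s <= l -> f r != d s /\ (adj (f r) (d s) -> r = m /\ i0 <= s <= j0).
  move=> rm sl; have [s00|sp] := posnP s.
    by rewrite s00 d0 fne // adj_sym (negPf (pf r rm)).
  have sl' : 0 < s <= l by rewrite sp.
  split; first exact: fD.
  move: rm; rewrite leq_eqVlt => /predU1P[->|rm]; last by rewrite (negPf (fsep' r s rm sl')).
  by move=> /(ext' s sl').
have fv r x : r <= m -> adj x (f r) -> via (seg f 0 r.+1) x y'.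
  move=> rm xr; exists (f r), p'; split=> //; last exact: py'.
  - by apply: mem_seg; nlia.
  - rewrite linked_sym -f0; apply: (ipath_link fp) => // s sr.
    by apply: mem_seg; nlia.
(* As for [leg_triangle], a single neighbour or a gap gives a theta, now with the second end [y'] in
   the interface of [j]. *)
have [eij|[jS|gap]] : i0 = j0 \/ (j0 = i0.+1 \/ i0.+1 < j0) by nlia.
- exfalso; subst i0; have jl : j0 <= l := ltnW j0l.
  have jC : d j0 \in C i by apply: (leg_core dl).
  have [ne nadj] := andP (apart_core ij jC (K_A yK')).
  have v2 : via (seg f 0 m.+1) (d j0) y' by apply: fv; rewrite // adj_sym.
  have v3 : via (seg d j0.+1 l.+1 :|: (a |: (z |: C k))) (d j0) y'.
    by apply: (tail_via_K dl) => //; rewrite (leg_adj dl) // eqxx.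
  have v1 : via (seg d 0 j0) (d j0) y'.
    rewrite -(prednK j00); apply: headv; first by nlia.
    by rewrite prednK // (leg_adj dl) //; nlia.
  apply: (theta_via free ne nadj v1 v2 v3).
  + apply: apart_sym => _ _ /segP[r rm ->] /segP[t tj ->].
    by apply: fseg_d; nlia.
  + apply: (tail_apart jp dl zK); first exact: (leg_split dl).
      by move=> u; apply: da.
    by apply: dfk; nlia.
  + apply: (tail_apart jp dl zK); last exact: fk.
      move=> _ _ /segP[r rm ->] /segP[t tj ->].
      by apply: fseg_d; nlia.
    by move=> _ /segP[r rm ->]; apply: fa; nlia.
- subst j0; have i0l : 0 < i0 < l by nlia.
  have [m1|m1] : m = 1 \/ 1 < m by nlia.
  + have [i1|i1] : i0 = 1 \/ 1 < i0 by nlia.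
    * have ef : e = f 1 by rewrite /e m1.
      exists (d 1), e, (d 2), (d l), (seg d 2 l.+1); subst i0.
      split.
      - split=> //; first by rewrite mem_seg //.
        by split; [rewrite adj_sym | rewrite mem_seg //; nlia].
      - split.
        + by rewrite -d0 (leg_adj dl) // ltnW.
        + exact: pf.
        + by have [_ h] := fp 0 m (leq0n m) (leqnn m); rewrite -f0 h m1.
        + by apply: nhit; nlia.
      - split=> //; first by rewrite adj_sym.
          by rewrite (leg_adj dl) //; nlia.
        apply: (leg_link dl) => // s sl; by apply: mem_seg.
      - by apply/subsetP=> _ /segP[s sl ->]; apply: (leg_core dl); nlia.
      move=> _ /segP[s sl ->]; have sl' : s <= l by nlia.
      split.
      - rewrite (leg_eq dl) // 1?ltnW // (leg_adj dl) // 1?ltnW //; split; first nlia.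
        by move=> h; have -> : s = 2 by nlia.
      - have sl'' : 0 < s <= l by nlia.
        split; first by rewrite eq_sym fD.
        by move=> /(ext' s sl'') h; have -> : s = 2 by nlia.
      - by rewrite -d0 (leg_adj dl) //; nlia.
      - exact: nhit.
      by rewrite (leg_a jp dl) // => h; have -> : s = l by nlia.
    exfalso.
    apply: (@leg_side_prism p d l i0 (seg f 1 m.+1) e (f 1) y jp dl) => //; first nlia.
    * by apply/subsetP=> _ /segP[s sm ->]; apply: fW; nlia.
    * by rewrite mem_seg // m0 /=.
    * rewrite linked_sym; apply: (ipath_link fp) => // s sm; exact: mem_seg.
    * by rewrite mem_seg.
    * by rewrite -d'f // adj_sym yhit' //; rewrite /l'; nlia.
    * move=> _ s /segP[r rm ->] sl; have rm' : r <= m by nlia.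
      have [ne h] := fall r s rm' sl; split=> // /h[-> hs].
      by split=> //; nlia.
  exfalso; have jl : i0.+1 <= l by nlia.
  have e1 : d' m.+1 = d i0.+1 by rewrite -[m.+1]addn0 -(subnn i0.+1) d'd.
  have ml' : 1 < m < l' by rewrite m1 /l'; nlia.
  apply: (@leg_side_prism p' d' l' m (seg d 1 i0.+1) (d i0) (d 1) y jp' fl' ml') => //.
  + by apply/subsetP=> _ /segP[s si ->]; apply: dW; nlia.
  + by rewrite mem_seg //; nlia.
  + rewrite linked_sym; apply: (leg_link dl); [nlia | nlia |].
    by move=> s si; apply: mem_seg.
  + by rewrite mem_seg.
  + by rewrite adj_sym yhit // ltnW.
  + by rewrite d'f // adj_sym.
  + by rewrite e1 (leg_adj dl) ?eqxx //; nlia.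
  move=> _ s /segP[r ri ->] sl; have rl : r <= l by nlia.
  have [sm|sm] := leqP s m.
    rewrite d'f // eq_sym adj_sym; have [ne h] := fall s r sm rl; split=> // /h[-> hr].
    by split; [congr d; nlia | left].
  have es : d' s = d (i0.+1 + (s - m.+1)).
    by rewrite /d' ifF //; nlia.
  have sl'' : i0.+1 + (s - m.+1) <= l by move: sl; rewrite /l'; nlia.
  rewrite es (leg_eq dl) // (leg_adj dl) //; split; first by nlia.
  by move=> h; split; [congr d; nlia | right; nlia].
exfalso; have il : i0 <= l by nlia.
have jl : j0 <= l by nlia.
have eC := W_core eW.
have [ne nadj] := andP (apart_core ij eC (K_A yK')).
have v1 := headv i0 e il ei.
have v2 : via (seg f 0 m) e y'.
  rewrite -(prednK m0); have m1 : m.-1 <= m by nlia.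
  by apply: fv => //; have [_ ->] := fp m m.-1 (leqnn m) m1; nlia.
have v3 : via (seg d j0 l.+1 :|: (a |: (z |: C k))) e y' by apply: (tail_via_K dl).
apply: (theta_via free ne nadj v1 v2 v3).
- apply: apart_sym => _ _ /segP[r rm ->] /segP[t tj ->].
  by apply: fseg_d; nlia.
- apply: (tail_apart jp dl zK); first exact: (leg_split dl).
    by move=> u; apply: da; nlia.
  by apply: dfk; nlia.
apply: (tail_apart jp dl zK); last by apply: fk.
  move=> _ _ /segP[r rm ->] /segP[t tj ->].
  by apply: fseg_d; nlia.
by move=> _ /segP[r rm ->]; apply: fa; nlia.
Qed.

End JewelPairs.

(** The triangles found in the two cores are the ends of a prism whose sides pass through [p], [p']
    and [a]. *)
Lemma jewel_clique i j k p p' : i != j -> i != k -> j != k ->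
  jewel i j k p -> jewel i j k p' -> p != p' -> adj p p'.
Proof.
move=> ij ik jk jp jp' pp'; apply/negPn/negP=> npp'.
have ji : j != i by rewrite eq_sym.
have [b [g [c [n [L]]]]] := jewel_pair_side ij ik jk jp jp' pp' npp'.
case=> -[bW gW cL [na nL]] [pb npg p'g np'b] [bg bc gc cn] LC LP.
have [b' [g' [c' [n' [L']]]]] :=
  jewel_pair_side ji jk ik (jewel_sym jp) (jewel_sym jp') pp' npp'.
case=> -[bW' gW' cL' [na' nL']] [pb' npg' p'g' np'b'] [bg' bc' gc' cn'] LC' LP'.
have [pa pA _ _ _] := jp; have [pa' pA' _ _ _] := jp'.
have cross u v : u \in C i -> v \in C j -> (u != v) && ~~ adj u v.
  by move=> uC vC; apply: (apart_core ij uC (core_A vC)).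
have adj_neq u v : adj u v -> u != v by apply: contraTneq => ->; rewrite adj_irrefl.
have pne u r : u \in C r -> p != u by move=> uC; apply: contraNneq (pA r) => ->; apply: core_A.
have pne' u r : u \in C r -> p' != u by move=> uC; apply: contraNneq (pA' r) => ->; apply: core_A.
have bC := W_core bW; have gC := W_core gW; have bC' := W_core bW'; have gC' := W_core gW'.
have LiC u : u \in L -> u \in C i by apply: (subsetP LC).
have LjC u : u \in L' -> u \in C j by apply: (subsetP LC').
have noa u r : u \in W r -> u != a /\ ~~ adj u a.
  by move=> uW; rewrite (A_neq (core_A (W_core uW))) adj_sym (W_nadj uW).
apply: (@no_prism _ b g c b' g' c' [set b; p; b'] [set g; p'; g'] (a |: (L :|: L')) free) => //.
- have h u v : u \in C i -> v \in C j -> u != v by move=> uC vC; case/andP: (cross u v uC vC).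
  by split; [exact: h | exact: h | apply: h; [exact: LiC | exact: LjC]].
- by split; rewrite ?memE ?eqxx ?cL ?orbT.
- split.
  + apply: (@linked_trans _ _ p); apply: linked1; rewrite ?memE ?eqxx ?orbT //.
    by rewrite adj_sym.
  + apply: (@linked_trans _ _ p'); apply: linked1; rewrite ?memE ?eqxx ?orbT //.
    by rewrite adj_sym.
  apply: (@linked_trans _ _ n).
    by apply: linkedS cn; rewrite setUA subsetU ?subsetUr.
  apply: (@linked_trans _ _ a); first by apply: linked1; rewrite ?memE ?eqxx ?nL ?orbT.
  apply: (@linked_trans _ _ n'); last first.
    by rewrite linked_sym; apply: linkedS cn'; rewrite setUA subsetUr.
  by apply: linked1; rewrite ?memE ?eqxx ?nL' ?orbT // adj_sym.
- move=> u v; rewrite !memE => /orP[/orP[]|]/eqP-> /orP[/orP[]|]/eqP->.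
  + by split; [apply: adj_neq | left].
  + by apply: apart_edge_sym; rewrite (pne' _ _ bC).
  + by apply: apart_edge; apply: cross.
  + by apply: apart_edge; rewrite (pne _ _ gC).
  + by apply: apart_edge; rewrite pp'.
  + by apply: apart_edge; rewrite (pne _ _ gC').
  + by apply: apart_edge_sym; apply: cross.
  + by apply: apart_edge_sym; rewrite (pne' _ _ bC').
  + by split; [apply: adj_neq | right].
- move=> u v; rewrite !memE => /orP[/orP[]|]/eqP-> /predU1P[->|/orP[]vL].
  + by apply: apart_edge; case: (noa _ _ bW) => -> ->.
  + have [[ne h] _ _ _ _] := LP v vL; rewrite eq_sym; split=> // /h->; by left.
  + by apply: apart_edge; apply: cross => //; apply: LjC.
  + by apply: apart_edge; rewrite pa out_nadj.
  + by apply: apart_edge; rewrite (pne _ _ (LiC _ vL)); case: (LP v vL).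
  + by apply: apart_edge; rewrite (pne _ _ (LjC _ vL)); case: (LP' v vL).
  + by apply: apart_edge; case: (noa _ _ bW') => -> ->.
  + by apply: apart_edge_sym; apply: cross => //; apply: LiC.
  + have [[ne h] _ _ _ _] := LP' v vL; rewrite eq_sym; split=> // /h->; by right.
move=> u v; rewrite !memE => /orP[/orP[]|]/eqP-> /predU1P[->|/orP[]vL].
+ by apply: apart_edge; case: (noa _ _ gW) => -> ->.
+ have [_ [ne h] _ _ _] := LP v vL; rewrite eq_sym; split=> // /h->; by left.
+ by apply: apart_edge; apply: cross => //; apply: LjC.
+ by apply: apart_edge; rewrite pa' out_nadj.
+ by apply: apart_edge; rewrite (pne' _ _ (LiC _ vL)); case: (LP v vL).
+ by apply: apart_edge; rewrite (pne' _ _ (LjC _ vL)); case: (LP' v vL).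
+ by apply: apart_edge; case: (noa _ _ gW') => -> ->.
+ by apply: apart_edge_sym; apply: cross => //; apply: LiC.
have [_ [ne h] _ _ _] := LP' v vL; rewrite eq_sym; split=> // /h->; by right.
Qed.

(** If [p] saw only one core, then [outside_K] in both directions would make it complete or
    anticomplete to the other two interfaces together, and it could be added to the tripod. *)
Lemma outside_jewel i p u : full a A K -> p != a -> (forall i', p \notin A i') ->
  u \in C i -> adj p u ->
  exists j k, [/\ i != j, i != k, j != k & jewel i j k p].
Proof.
move=> F pa pA uC pu.
have [j [k [ij ik jk tri]]] := other_indices i; have kj : k != j by rewrite eq_sym.
have step j' k' : i != j' -> i != k' -> j' != k' ->
    (exists2 v, v \in C j' & adj p v) -> jewel i j' k' p.
  move=> ij' ik' jk' [v vC pv]; split=> //; [by exists u | by exists v |].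
  by move=> w wA; apply: (outside_two ij' ik' jk' pa pA uC vC wA pu pv).
have [hj|nj] := classic (exists2 v, v \in C j & adj p v).
  by exists j, k; split=> //; apply: step.
have [hk|nk] := classic (exists2 v, v \in C k & adj p v).
  by exists k, j; split=> //; apply: step.
exfalso; have cw : exists2 u, u \in core A K i & adj p u by exists u.
have njC v : v \in C j -> ~~ adj p v by move=> vC; apply/negP=> pv; apply: nj; exists v.
have nkC v : v \in C k -> ~~ adj p v by move=> vC; apply/negP=> pv; apply: nk; exists v.
have jK y z := outside_K ij ik jk pa pA njC nkC uC (y := y) (z := z).
have kK y z := outside_K ik ij kj pa pA nkC njC uC (y := y) (z := z).
have other j' : j' != i -> (j' = j) \/ (j' = k).
  by move=> ji; case: (tri j') => [e|]; [rewrite e eqxx in ji | ].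
pose c := [exists y in K j, adj p y].
have Kadj v : v \in K j \/ v \in K k -> adj p v = c.
  move=> vK; apply/idP/idP=> [pv|/existsP[y /andP[yK py]]].
    case: vK => vK; first by apply/existsP; exists v; rewrite vK.
    by have [b bK] := tp_b T j; apply/existsP; exists b; rewrite bK /=; apply: kK pv.
  case: vK => vK; last exact: jK py.
  by have [b bK] := tp_b T k; apply: (kK b v bK vK pu); apply: (jK y b yK bK pu).
apply: (full_add (c := c) T F pa pA cw) => j' v /other jk' vA.
have [vK|vK] := boolP (v \in K j').
  by rewrite andbT; apply: Kadj; case: jk' => <-; [left | right].
have vC : v \in C j' by rewrite inE vK.
by rewrite andbF; apply: negbTE; case: jk' vC => ->; [apply: njC | apply: nkC].
Qed.

End Jewels.

(** * Separation at one branch vertex *)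

Section LocalCut.
Variable G : sgraph.
Implicit Types (Q R : {set G}) (u v x : G) (A K : 'I_3 -> {set G}).

Definition cliques_below t Q := forall R, R \subset Q -> clique R -> #|R| < t.

Lemma cliques_belowS t Q Q' : Q \subset Q' -> cliques_below t Q' -> cliques_below t Q.
Proof. by move=> QQ' h R RQ; apply: h; apply: subset_trans RQ QQ'. Qed.

Lemma clique_sub Q R : R \subset Q -> clique Q -> clique R.
Proof.
move=> /subsetP RQ /'forall_implyP Qcl; apply/'forall_implyP=> u uR.
apply/'forall_implyP => v vR.
by have /'forall_implyP := Qcl u (RQ u uR); apply; apply: RQ.
Qed.

Lemma cliques_belowT t : ~ (exists R : {set G}, clique R /\ #|R| = t) ->
  cliques_below t [set: G].
Proof.
move=> none R _ Rcl; rewrite ltnNge; apply/negP=> tR; apply: none.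
pose s := take t (enum R).
have us : uniq s by apply: take_uniq; apply: enum_uniq.
exists [set x in s]; split.
  apply: clique_sub Rcl; apply/subsetP=> x; rewrite inE => /mem_take.
  by rewrite mem_enum.
by rewrite cardsE (card_uniqP us) size_takel // -cardE.
Qed.

Lemma cliqueP Q : reflect {in Q &, forall u v, u != v -> adj u v} (clique Q).
Proof.
apply: (iffP 'forall_implyP) => [h u v uQ vQ|h u uQ].
  by have /'forall_implyP/(_ v vQ)/implyP := h u uQ.
by apply/'forall_implyP=> v vQ; apply/implyP; apply: h.
Qed.

Definition no_stable_triple Q := forall u v x, u \in Q -> v \in Q -> x \in Q ->
  u != v -> u != x -> v != x -> [|| adj u v, adj u x | adj v x].

(** Ramsey bound: the nonneighbours of a vertex form a clique, and among its neighbours the clique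
    bound drops by one. *)
Lemma card_no_stable_triple t Q : cliques_below t Q -> no_stable_triple Q -> #|Q| <= t * t.
Proof.
elim: t Q => [|t IH] Q below st.
  have := below set0 (sub0set Q); rewrite cards0 ltn0 => h.
  suff : false by []; apply: h; apply/cliqueP=> u v; by rewrite inE.
have [->|[v vQ]] := set_0Vmem Q; first by rewrite cards0.
pose N := [set u in Q | adj v u]; pose M := [set u in Q | (u != v) && ~~ adj v u].
have Mcl : clique M.
  apply/cliqueP=> x y; rewrite !inE => /and3P[xQ xv nx] /and3P[yQ yv ny] xy.
  have := st v x y vQ xQ yQ; rewrite (negPf nx) (negPf ny) ![v == _]eq_sym.
  exact.
have MQ : M \subset Q by apply/subsetP=> u; rewrite inE => /andP[].
have NQ : N \subset Q by apply/subsetP=> u; rewrite inE => /andP[].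
have Mt : #|M| < t.+1 by apply: below.
have Nt : #|N| <= t * t.
  apply: IH; last by move=> x y z /(subsetP NQ) xQ /(subsetP NQ) yQ /(subsetP NQ); apply: st.
  move=> R RN Rcl; have vR : v \notin R.
    by apply/negP=> /(subsetP RN); rewrite inE adj_irrefl andbF.
  suff : #|v |: R| < t.+1 by rewrite cardsU1 vR.
  apply: below; first by rewrite subUset sub1set vQ (subset_trans RN).
  have vadj u : u \in R -> adj v u by move/(subsetP RN); rewrite inE => /andP[].
  apply/cliqueP=> x y /setU1P[->|xR] /setU1P[->|yR]; rewrite ?eqxx // => xy.
  - exact: vadj.
  - by rewrite adj_sym vadj.
  by move/cliqueP: Rcl; apply.
have Qsub : Q \subset v |: (N :|: M).
  by apply/subsetP=> u uQ; rewrite !inE uQ /=; case: eqP => //=; case: (adj v u).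
have := subset_leq_card Qsub; rewrite cardsU1.
have := leq_of_leqif (leq_card_setU N M); have : (v \notin N :|: M) <= 1 by case: (_ \notin _).
by nlia.
Qed.

Variables (a : G) (t : nat).
Hypothesis free : theta_prism_free G.
Hypothesis pendant : forall n u v : G,
  adj a n -> adj n u -> adj n v -> u != a -> v != a -> u = v.
Hypothesis small_cliques : cliques_below t [set: G].

Lemma small_parts A K : tripod a A K ->
  exists i0, forall j, j != i0 -> #|K j| <= t * t.
Proof.
move=> T; have [all|some] := classic (forall i, no_stable_triple (K i)).
  exists ord0 => j _; apply: card_no_stable_triple => //.
  by apply: cliques_belowS small_cliques; apply: subsetT.
have [i ni] := not_all_ex_not _ _ some; exists i => j ji.
suff Kcl : clique (K j).
  have := small_cliques (subsetT _) Kcl; nia.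
apply/cliqueP=> u v uK vK uv; apply/negPn/negP=> nuv; apply: ni => x y z xK yK zK xy xz yz.
apply/negPn/negP; rewrite !negb_or => /and3P[nxy nxz nyz].
have adjK w w' : w \in K i -> w' \in K j -> adj w w' && adj w' w.
  move=> wK wK'; rewrite (adj_sym w') andbb.
  by rewrite (tp_adj T _ (K_A T wK) (K_A T wK')) ?wK // eq_sym.
have v1 w : w \in K i -> via [set w] u v.
  move=> wK; exists w, w; rewrite set11 linked_refl.
  by have /andP[-> _] := adjK w v wK vK; have /andP[_ ->] := adjK w u wK uK.
apply: (theta_via free uv nuv (v1 x xK) (v1 y yK) (v1 z zK)).
- by move=> _ _ /set1P-> /set1P->; rewrite xy.
- by move=> _ _ /set1P-> /set1P->; rewrite xz.
by move=> _ _ /set1P-> /set1P->; rewrite yz.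
Qed.

(** For a full tripod these are the jewels of all three kinds, collected in a decidable set to be
    put into a cut. *)
Definition outer A K : {set G} := [set p | [&& p != a, [forall i, p \notin A i] &
  [exists i, [exists u in core A K i, adj p u]]]].

Lemma outerN A K i u v : v != a -> v \notin outer A K -> u \in core A K i -> adj u v ->
  exists i', v \in A i'.
Proof.
move=> va vJ uC uv; apply: NNPP => none; case/negP: vJ; rewrite inE va /=; apply/andP; split.
  by apply/forallP=> i'; apply/negP=> vA; apply: none; exists i'.
by apply/existsP; exists i; apply/existsP; exists u; rewrite uC adj_sym.
Qed.

Lemma outer_jewel A K p : tripod a A K -> full a A K -> p \in outer A K ->
  exists i j k, [/\ i != j, i != k, j != k & jewel a A K i j k p].
Proof.
move=> T F; rewrite inE => /and3P[pa /forallP pA /existsP[i /existsP[u /andP[uC pu]]]].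
have [j [k [ij ik jk jp]]] := outside_jewel free T F pa pA uC pu.
by exists i, j, k.
Qed.

(** Jewels are sorted by the part they miss; each of the three classes is a clique. *)
Lemma card_outer A K : tripod a A K -> full a A K -> #|outer A K| <= 3 * t.
Proof.
move=> T F.
pose J i := [set p in outer A K | [forall u in A i, ~~ adj p u]].
have Jt i : #|J i| <= t.
  apply: ltnW; apply: small_cliques (subsetT _) _; apply/cliqueP=> p p'.
  rewrite !inE -!andbA => /and4P[pa /forallP pA pe pi] /and4P[pa' /forallP pA' pe' pi'] pp'.
  have [j [k [ij ik jk tri]]] := other_indices i.
  have key q : q != a -> (forall i, q \notin A i) ->
     [exists i, [exists u in core A K i, adj q u]] -> [forall u in A i, ~~ adj q u] ->
     jewel a A K j k i q.
    move=> qa qA qe qi; have : q \in outer A K by rewrite inE qa qe andbT; apply/forallP.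
    case/(outer_jewel T F)=> i1 [j1 [k1 [ij1 ik1 jk1 jq]]].
    have nu u : u \in A i -> ~~ adj q u.
      by move=> uA; have /forallP/(_ u) := qi; rewrite uA.
    have [_ _ [u uC qu] [v vC qv] _] := jq.
    have ni1 : i1 != i.
      by apply: contraTneq qu => e; apply: nu; rewrite -e; apply: core_A uC.
    have nj1 : j1 != i.
      by apply: contraTneq qv => e; apply: nu; rewrite -e; apply: core_A vC.
    split=> //.
      case: (tri i1) => [e|[e|e]]; first by rewrite e eqxx in ni1.
        by exists u; rewrite -?e.
      case: (tri j1) => [e1|[e1|e1]]; first by rewrite e1 eqxx in nj1.
        by exists v; rewrite -?e1.
      by rewrite e e1 eqxx in ij1.
    case: (tri i1) => [e|[e|e]]; first by rewrite e eqxx in ni1.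
      case: (tri j1) => [e1|[e1|e1]]; first by rewrite e1 eqxx in nj1.
        by rewrite e e1 eqxx in ij1.
      by exists v; rewrite -?e1.
    by exists u; rewrite -?e.
  have ji : j != i by [rewrite eq_sym]; have ki : k != i by rewrite eq_sym.
  apply: (jewel_clique free pendant T jk ji ki _ _ pp'); exact: key.
have sub : outer A K \subset \bigcup_i J i.
  apply/subsetP=> p pJ; have [i [j [k [ij ik jk [_ _ _ _ nk]]]]] := outer_jewel T F pJ.
  apply/bigcupP; exists k => //; rewrite inE pJ; apply/forallP=> u; apply/implyP.
  exact: nk.
apply: leq_trans (subset_leq_card sub) _.
apply: (@leq_trans (\sum_i #|J i|)).
  elim/big_ind2: _ => [|m R m' R' h h'|//]; first by rewrite cards0.
  by apply: leq_trans (leq_card_setU _ _) (leq_add h h').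
by apply: leq_trans (leq_sum _ (fun i _ => Jt i)) _; rewrite sum_nat_const card_ord.
Qed.

(* The condition on [b] keeps [x] out of the interfaces and away from the jewels, since
   both are complete to two of the interfaces. *)
Lemma local_cut A0 K0 (b : 'I_3 -> G) x : tripod a A0 K0 -> (forall i, b i \in K0 i) ->
  x != a -> ~~ adj a x -> (forall i j, i != j -> ~~ (adj x (b i) && adj x (b j))) ->
  exists (S : {set G}) i, [/\ a \notin S, x \notin S, #|S| <= 3 * t + 2 * (t * t) &
    forall n, adj a n -> linked (~: (a |: S)) x n -> n \in A0 i].
Proof.
move=> T0 bK0 xa nax far; have [A [K [T ext F]]] := full_extension T0.
have bK i : b i \in K i by have [_ /subsetP] := ext i; apply.
pose J := outer A K; have Jt : #|J| <= 3 * t by apply: card_outer.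
have xK i : x \notin K i.
  apply/negP=> xK; have [j [k [ij ik jk _]]] := other_indices i.
  have := far j k jk; rewrite (tp_adj T ij (K_A T xK) (K_A T (bK j))).
  by rewrite (tp_adj T ik (K_A T xK) (K_A T (bK k))) xK !bK.
have xJ : x \notin J.
  apply/negP=> /(outer_jewel T F)[i [j [k [ij ik jk jx]]]].
  have ji : j != i by rewrite eq_sym.
  have := far i j ij; rewrite (jewel_K free pendant T ij ik jk jx (bK i)).
  by rewrite (jewel_K free pendant T ji jk ik (jewel_sym jx) (bK j)).
have aJ : a \notin J by rewrite inE eqxx.
have aK i : a \notin K i by apply: contra (tp_a T i) => /(K_A T).
(* Neighbours of [a] already lie in the initial cores, so enlarging the tripod does not move them to
   another part. *)
have back i n : adj a n -> n \in A i -> n \in A0 i.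
  move=> /(tp_N T0)[i' /core_A ni'] ni; have [<-//|ii'] := eqVneq i' i.
  by have := tp_disj T ii' (subsetP (ext i').1 _ ni'); rewrite ni.
have [i0 small] := small_parts T.
(* Inside a part with small interface, that interface and the jewels enclose [x] in the core. *)
have [[j ji xA]|xA] := classic (exists2 j, j != i0 & x \in A j).
  exists (J :|: K j), j; split.
  - by rewrite inE negb_or aJ aK.
  - by rewrite inE negb_or xJ xK.
  - by apply: leq_trans (leq_card_setU _ _) _; have := small j ji; nlia.
  move=> n an xn; apply: back => //; apply: core_A (_ : n \in core A K j).
  apply: (linked_inv xn); last by rewrite inE xK.
  move=> u v uC _; rewrite in_setC in_setU1 in_setU !negb_or => /and3P[va vJ vK] uv.
  have [i' vA'] := outerN va vJ uC uv; rewrite in_setD vK /=.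
  apply/negPn/negP=> vA; have ji' : j != i' by apply: contraNneq vA => ->.
  by have /andP[_] := apart_core T ji' uC vA'; rewrite uv.
(* Otherwise the two small interfaces and the jewels bar [x] from entering the parts [j] and [k],
   and the possibly large [K i0] need not be removed. *)
have [j [k [ij ik jk tri]]] := other_indices i0.
have ji : j != i0 by [rewrite eq_sym]; have ki : k != i0 by rewrite eq_sym.
exists (J :|: (K j :|: K k)), i0; split.
- by rewrite !in_setU !negb_or aJ !aK.
- by rewrite !in_setU !negb_or xJ !xK.
- apply: leq_trans (leq_card_setU _ _) _; have := leq_of_leqif (leq_card_setU (K j) (K k)).
  by have := small j ji; have := small k ki; nlia.
move=> n an xn; apply: back => //.
suff nA : n \in ~: (A j :|: A k).
  have [i' /core_A nA'] := tp_N T an; move: nA; rewrite !inE negb_or => /andP[nj nk].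
  by case: (tri i') nA' => [->//|[->|->]]; rewrite ?(negPf nj) ?(negPf nk).
apply: (linked_inv xn); last first.
  rewrite !inE negb_or; apply/andP; split; apply/negP=> h; apply: xA; by [exists j | exists k].
move=> u v; rewrite !in_setC !in_setU1 !in_setU !negb_or.
move=> /andP[uj uk] /and4P[ua uJ _ _] /and4P[va vJ vj vk] uv.
suff key i' : i' != i0 -> u \notin A i' -> v \notin K i' -> v \notin A i' by rewrite !key.
move=> ii' uA vK; apply/negP=> vA; have vC : v \in core A K i' by rewrite inE vK.
have vu : adj v u by rewrite adj_sym.
have [i1 uA1] := outerN ua uJ vC vu.
have i1i' : i' != i1 by apply: contraNneq uA => ->.
by have /andP[_] := apart_core T i1i' vC uA1; rewrite vu.
Qed.

End LocalCut.

(** * Arms of a tree *)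

Lemma linked_first (G : sgraph) (U : {set G}) x y : linked U x y -> x != y ->
  exists z, [/\ adj x z, z \in U & linked (U :\ x) z y].
Proof.
move=> /linked_shortest[p [[[xp py up] _] pU]] xy.
case: p xp py up pU => [|z p] /=; first by move=> _ e; rewrite e eqxx in xy.
case/andP=> xz zp py /and3P[xz' _ _] /andP[zU pU]; exists z; split=> //.
have all' : all (mem (U :\ x)) (z :: p).
  apply/allP=> u; rewrite [in X in X -> _]inE => up /=; rewrite !inE; apply/andP; split.
    by apply: contraNneq xz' => <-; rewrite inE.
  by case/predU1P: up => [->//|/(allP pU)].
elim: p z {xz xz' zU pU} zp py all' => [|u p IH] z /=; first by move=> _ ->; rewrite linked_refl.
case/andP=> zu up uy /and3P[zU uU pU]; apply: (@linked_trans _ _ u).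
  exact: linked1.
by apply: IH => //=; rewrite uU.
Qed.

Lemma linked_within (G : sgraph) (U V : {set G}) x y : linked U x y ->
  (forall z, linked U x z -> z \in V) -> linked V x y.
Proof.
move=> xy UV; suff : y \in [set z | linked U x z && linked V x z] by rewrite inE => /andP[].
apply: (linked_inv xy); last by rewrite inE !linked_refl.
move=> u v; rewrite !inE => /andP[xu xu'] uU vU uv.
have xv : linked U x v by apply: linked_trans xu _; apply: linked1.
by rewrite xv /=; apply: linked_trans xu' _; apply: linked1; rewrite ?UV.
Qed.

Section Arms.
Variable C : sgraph.
Hypotheses (connC : forall x y : C, connect adj x y) (acyC : acyclic C).
Implicit Types u v w x y z p q : C.

(** For adjacent [v] and [w], the component of the tree minus [v] that contains [w]. *)
Definition arm v w : {set C} := [set u | linked (~: [set v]) w u].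

Lemma adj_neq (G : sgraph) (x y : G) : adj x y -> x != y.
Proof. by apply: contraTneq => ->; rewrite adj_irrefl. Qed.

Lemma arm_self v w : w \in arm v w.
Proof. by rewrite inE linked_refl. Qed.

Lemma arm_root v w : adj v w -> v \notin arm v w.
Proof.
move=> vw; rewrite inE; apply/negP=> /linked_mem.
by rewrite !inE eqxx eq_sym adj_neq // => /(_ isT).
Qed.

(** A path joining two different neighbours of [v] outside [v] would close to a cycle. *)
Lemma arm_unique v w w' u : adj v w -> adj v w' -> u \in arm v w -> u \in arm v w' -> w = w'.
Proof.
move=> vw vw'; rewrite !inE => wu; rewrite linked_sym => uw'.
have /linked_shortest[p [[[wp pw' up] _] pU]] := linked_trans wu uw'.
apply/eqP; case: p wp pw' up pU => [|z p] wp pw' up pU; first by apply/eqP.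
have cyc : ucycle adj [:: v, w, z & p]; last by have := acyC cyc.
rewrite /ucycle /=; move: wp up pU pw' => /= /andP[-> zp] -> /andP[zU pU] pw'.
rewrite vw rcons_path zp pw' adj_sym vw' /= andbT !inE !negb_or (adj_neq vw) /=.
move: zU; rewrite !inE eq_sym => -> /=; apply/negP=> /(allP pU).
by rewrite /= !inE eqxx.
Qed.

Lemma arm_cover v u : u != v -> exists2 w, adj v w & u \in arm v w.
Proof.
move=> uv; have vu : linked setT v u.
  by apply: connect_sub (connC v u) => x y xy; apply: connect1; rewrite link_relE !inE.
rewrite eq_sym in uv; have [w [vw _ wu]] := linked_first vu uv.
by exists w; rewrite // inE; apply: linkedS wu; rewrite setTD.
Qed.

Lemma arm_step v w u : u \in arm v w -> u != w ->
  exists w', [/\ adj w w', w' != v & u \in arm w w'].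
Proof.
rewrite inE eq_sym => wu uw; have [z [wz zv zu]] := linked_first wu uw.
exists z; split=> //; first by move: zv; rewrite !inE.
by rewrite inE; apply: linkedS zu; apply: subsetDr.
Qed.

Lemma arm_closed v w u x : adj v w -> u \in arm v w -> adj u x -> x != v -> x \in arm v w.
Proof.
rewrite !inE => vw wu ux xv; apply: (linked_trans wu).
apply: linked1; rewrite ?inE //; apply: contraTneq wu => ->.
by have := arm_root vw; rewrite inE.
Qed.

Lemma arm_sub v w p q : adj v w -> adj p q -> v \notin arm p q -> p \in arm v w ->
  arm p q \subset arm v w.
Proof.
move=> vw pq vpq pvw; apply/subsetP=> u uq.
have qv : q != v by apply: contraNneq vpq => <-; apply: arm_self.
have pv : p != v by apply: contraTneq pvw => ->; apply: arm_root.
have : linked (~: [set v]) q u.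
  rewrite inE in uq; apply: (linked_within uq) => z qz; rewrite !inE.
  by apply: contraNneq vpq => <-; rewrite inE.
move=> qu; rewrite inE in pvw; rewrite inE; apply: linked_trans pvw (linked_trans _ qu).
by apply: linked1; rewrite ?inE.
Qed.

Lemma arm_trans v w w' : adj v w -> adj w w' -> w' != v -> arm w w' \subset arm v w.
Proof.
move=> vw ww' w'v; apply: arm_sub => //; last exact: arm_self.
apply/negP=> vin; have wv : adj w v by rewrite adj_sym.
by move: w'v; rewrite (arm_unique ww' wv vin (arm_self _ _)) eqxx.
Qed.

(** A common vertex would lead from [q] to [w], and on to [v], without passing through [p]. *)
Lemma arm_disjoint v w p q u : adj v w -> adj p q -> v != p -> v \notin arm p q ->
  p \notin arm v w -> u \in arm v w -> u \notin arm p q.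
Proof.
move=> vw pq vp vpq pvw uvw; apply/negP=> upq; case/negP: vpq.
have uv : linked (~: [set p]) u w.
  rewrite linked_sym; rewrite inE in uvw; apply: (linked_within uvw) => z wz; rewrite !inE.
  by apply: contraNneq pvw => <-; rewrite inE.
rewrite inE in upq; rewrite inE; apply: linked_trans upq (linked_trans uv _).
apply: linked1; rewrite ?inE // 1?adj_sym //.
by apply: contraNneq pvw => <-; apply: arm_self.
Qed.

(** The measure for the inductions that walk outwards along the tree. *)
Lemma card_arm v w w' : adj v w -> adj w w' -> w' != v -> #|arm w w'| < #|arm v w|.
Proof.
move=> vw ww' w'v; apply: proper_card; apply/properP; split; first exact: arm_trans.
by exists w; [exact: arm_self | exact: arm_root].
Qed.

Lemma arm_leaf v w : adj v w -> exists2 u, u \in arm v w & degree u = 1.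
Proof.
have [m] := ubnP #|arm v w|; elim: m v w => // m IH v w lem vw.
have vN : v \in nbhd w by rewrite inE adj_sym.
have [none|[w' /setD1P[w'v w'N]]] := set_0Vmem (nbhd w :\ v).
  exists w; first exact: arm_self.
  by rewrite /degree (cardsD1 v) vN none cards0.
rewrite inE in w'N; have lt := card_arm vw w'N w'v.
have [|u uA du] := IH w w' _ w'N; first exact: leq_trans lt _.
by exists u => //; apply: (subsetP (arm_trans vw w'N w'v)).
Qed.

End Arms.

(** * The seed described by the flags (vertex, incident edge) of the tree *)

Section Flags.
Variables (G C : sgraph) (a : G) (h : C -> C -> G).
Hypotheses (connC : forall x y : C, connect adj x y) (acyC : acyclic C).
Hypothesis h_inj : forall u w u' w', adj u w -> adj u' w' -> h u w = h u' w' -> u = u' /\ w = w'.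
Hypothesis h_adj : forall u w u' w', adj u w -> adj u' w' ->
  adj (h u w) (h u' w') = (u == u') && (w != w') || (u == w') && (w == u').
Hypothesis h_a : forall u w, adj u w -> h u w != a.
Hypothesis h_leaf : forall u w, adj u w -> adj a (h u w) = (degree u == 1).
Hypothesis nbhd_a : forall n, adj a n -> exists u w, adj u w /\ n = h u w.
Implicit Types u v w p q : C.

(* The vertices [h u u'] with [u] in the arm of [v] at [w]; the arm of the seed at the
   triangle of [v] consists of these and [h v w]. *)
Definition flags v w : {set G} :=
  [set z | [exists u in arm v w, [exists u', adj u u' && (z == h u u')]]].

Lemma flagsP v w z : reflect (exists u u', [/\ u \in arm v w, adj u u' & z = h u u'])
  (z \in flags v w).
Proof.
rewrite inE; apply: (iffP existsP) => [[u /andP[uA /existsP[u' /andP[uu' /eqP->]]]]|].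
  by exists u, u'.
by case=> u [u' [uA uu' ->]]; exists u; rewrite uA; apply/existsP; exists u'; rewrite uu' eqxx.
Qed.

Lemma mem_flags v w u u' : u \in arm v w -> adj u u' -> h u u' \in flags v w.
Proof. by move=> uA uu'; apply/flagsP; exists u, u'. Qed.

(** Flags at one vertex form a clique, and the two flags of an edge are adjacent, so connectivity of
    the arm carries over. The start [h w v] is the flag of the arm that faces [h v w]. *)
Lemma flags_linked v w u u' : adj v w -> u \in arm v w -> adj u u' ->
  linked (flags v w) (h w v) (h u u').
Proof.
move=> vw uA uu'; have wv : adj w v by rewrite adj_sym.
have turn x y y' : x \in arm v w -> adj x y -> adj x y' -> linked (flags v w) (h x y) (h x y').
  move=> xA xy xy'; have [->|ne] := eqVneq y y'; first exact: linked_refl.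
  by apply: linked1; rewrite ?mem_flags // h_adj // eqxx ne.
suff : u \in [set x in arm v w | [forall x', adj x x' ==> linked (flags v w) (h w v) (h x x')]].
  by rewrite inE => /andP[_ /forallP/(_ u')]; rewrite uu'.
have wu : linked (~: [set v]) w u by move: uA; rewrite inE.
have wA := arm_self v w; apply: (linked_inv wu); last first.
  by rewrite inE wA; apply/forallP=> x'; apply/implyP; apply: turn.
move=> x y; rewrite !inE => /andP[xA xl] xv yv xy.
have xA' : x \in arm v w by rewrite inE.
have yA := arm_closed vw xA' xy yv; move: (yA); rewrite inE => -> /=.
have yx : adj y x by rewrite adj_sym.
apply/forallP=> z; apply/implyP=> yz; apply: linked_trans (turn y x z yA yx yz).
have /forallP/(_ y) := xl; rewrite xy => /linked_trans; apply.
by apply: linked1; rewrite ?mem_flags // h_adj // !eqxx orbT.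
Qed.

(** An edge of the tree leaving the arm ends at [v], and its flag at [v] is [h v w] itself. The case
    [p = v] is excluded because all flags at [v] see [h v w]. *)
Lemma flags_apart v w p q : adj v w -> adj p q -> p \notin arm v w -> p != v ->
  apart (h v w |: flags v w) [set h p q].
Proof.
move=> vw pq pA pv z _ zQ /set1P->.
have [u [u' [hu uu' ->]]] : exists u u',
    [/\ u = v /\ u' = w \/ u \in arm v w, adj u u' & z = h u u'].
  move: zQ; rewrite in_setU1 => /predU1P[->|/flagsP[u [u' [uA uu' ->]]]].
    by exists v, w; split=> //; left.
  by exists u, u'; split=> //; right.
have up : u != p.
  by case: hu => [[-> _]|]; [rewrite eq_sym | apply: contraTneq => ->].
rewrite h_adj // (negPf up) /=; apply/andP; split.
  by apply: contraNneq up => e; case: (h_inj uu' pq e) => ->.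
apply/negP=> /andP[/eqP uq /eqP u'p].
case: hu => [[_ u'w]|uA]; first by move: pA; rewrite -u'p u'w arm_self.
by move: pA; rewrite (arm_closed vw uA) // -u'p.
Qed.

Lemma flags_apart2 v w p q : adj v w -> adj p q -> v != p -> v \notin arm p q -> p \notin arm v w ->
  apart (h v w |: flags v w) (h p q |: flags p q).
Proof.
move=> vw pq vp vpq pvw z y zQ; rewrite in_setU1 => /predU1P[->|/flagsP[u [u' [uA uu' ->]]]].
  by apply: (flags_apart vw pq pvw _ zQ (set11 _)); rewrite eq_sym.
apply: (flags_apart vw uu' _ _ zQ (set11 _)); last first.
  by apply: contraNneq vpq => <-.
by apply: contraL uA; apply: arm_disjoint.
Qed.

(** Every arm contains a leaf of the tree, and the flag of a leaf is a neighbour of [a]. *)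
Lemma flags_via v w x : adj v w -> adj x (h v w) -> via (h v w |: flags v w) x a.
Proof.
move=> vw xh; have [u uA du] := arm_leaf acyC vw; have [u' uu'] : exists u', adj u u'.
  have /card_gt0P[u' u'N] : 0 < #|nbhd u| by rewrite -/(degree u) du.
  by exists u'; rewrite inE in u'N.
exists (h v w), (h u u'); split=> //; first exact: setU11.
  have wv : adj w v by rewrite adj_sym.
  apply: (@linked_trans _ _ (h w v)); last first.
    by apply: linkedS (flags_linked vw uA uu'); apply: subsetUr.
  apply: linked1; rewrite ?setU11 ?setU1r ?mem_flags ?arm_self //.
  by rewrite h_adj // !eqxx orbT.
by rewrite adj_sym h_leaf // du.
Qed.

(** The interfaces are the single vertices of the triangle at [v], and the cores consist of the
    flags of the three arms. *)
Lemma branch_tripod v (w : 'I_3 -> C) : degree v = 3 -> injective w ->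
  (forall u, adj v u <-> exists i, u = w i) ->
  tripod a (fun i => h v (w i) |: flags v (w i)) (fun i => [set h v (w i)]).
Proof.
move=> dv winj wP; have vw i : adj v (w i) by apply/wP; exists i.
have vN i : h v (w i) \notin flags v (w i).
  apply/flagsP=> -[u [u' [uA uu' e]]]; have [vu _] := h_inj (vw i) uu' e.
  by case/negP: (arm_root (vw i)); rewrite [X in X \in _]vu.
have coreE i : core (fun i => h v (w i) |: flags v (w i)) (fun i => [set h v (w i)]) i
    = flags v (w i).
  by rewrite /core setU1K.
have flags_part i j u u' : i != j -> u \in arm v (w i) -> adj u u' ->
    (forall z, z \in h v (w j) |: flags v (w j) -> (z != h u u') && ~~ adj z (h u u')).
  move=> ij uA uu' z zQ; apply: (flags_apart (vw j) uu' _ _ zQ (set11 _)); last first.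
    by apply: contraTneq uA => ->; apply: arm_root.
  apply: contra ij => uA'; apply/eqP; apply: winj.
  exact: (arm_unique acyC (vw i) (vw j) uA uA').
have adjP i j (u u' : G) : i != j -> u \in h v (w i) |: flags v (w i) ->
    u' \in h v (w j) |: flags v (w j) ->
    u != u' /\ adj u u' = (u \in [set h v (w i)]) && (u' \in [set h v (w j)]).
  move=> ij uQ u'Q; have ji : j != i by rewrite eq_sym.
  case/setU1P: (uQ) => [eu|/flagsP[x [x' [xA xx' eu]]]]; last first.
    have /andP[n1 n2] := flags_part i j x x' ij xA xx' u' u'Q; rewrite eu eq_sym; split=> //.
    rewrite adj_sym (negPf n2); apply/esym/negbTE; rewrite negb_and; apply/orP; left.
    rewrite in_set1; apply: contraNneq (vN i) => <-; exact: mem_flags.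
  case/setU1P: (u'Q) => [eu'|/flagsP[x [x' [xA xx' eu']]]]; last first.
    have /andP[n1 n2] := flags_part j i x x' ji xA xx' u uQ; rewrite eu'; split=> //.
    rewrite (negPf n2); apply/esym/negbTE; rewrite negb_and; apply/orP; right.
    rewrite in_set1; apply: contraNneq (vN j) => <-; exact: mem_flags.
  have wij : w i != w j by apply: contra ij => /eqP /winj ->.
  rewrite eu eu' !set11 h_adj // eqxx wij; split=> //.
  by apply: contraNneq wij => e; case: (h_inj (vw i) (vw j) e) => _ ->.
split.
- by move=> i; apply: subsetUl.
- move=> i; rewrite in_setU1 negb_or eq_sym h_a //=; apply/flagsP=> -[u [u' [_ uu' e]]].
  by have := h_a uu'; rewrite -e eqxx.
- move=> i j u ij ui; apply/negP=> uj.
  by have [] := adjP i j u u ij ui uj; rewrite eqxx.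
- by move=> i j u u' ij ui uj; have [] := adjP i j u u' ij ui uj.
- move=> i x y; rewrite coreE => /flagsP[u [u' [uA uu' ->]]] /flagsP[z [z' [zA zz' ->]]].
  apply: (@linked_trans _ _ (h (w i) v)); last exact: flags_linked.
  by rewrite linked_sym; apply: flags_linked.
- move=> i u /set1P->; have wv : adj (w i) v by rewrite adj_sym.
  exists (h (w i) v); first by rewrite coreE mem_flags // arm_self.
  by rewrite h_adj // !eqxx orbT.
- by move=> i; exists (h v (w i)); rewrite set11.
- move=> i; have [u uA du] := arm_leaf acyC (vw i); have [u' uu'] : exists u', adj u u'.
    have /card_gt0P[u' u'N] : 0 < #|nbhd u| by rewrite -/(degree u) du.
    by exists u'; rewrite inE in u'N.
  by exists (h u u'); [rewrite coreE mem_flags | rewrite h_leaf // du].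
move=> n an; have [u [u' [uu' en]]] := nbhd_a an; move: an; rewrite en h_leaf // => /eqP du.
have uv : u != v by apply: contra_eq_neq du => ->; rewrite dv.
have [y vy uA] := arm_cover connC uv; have [i yi] := (wP y).1 vy.
by exists i; rewrite coreE mem_flags -?yi.
Qed.

Hypothesis free : theta_prism_free G.
Variable x : G.
Hypotheses (xa : x != a) (nax : ~~ adj a x).

(** The branch vertices at which the hypothesis of [local_cut] on the triangle fails. *)
Definition near_branch v := (degree v == 3) && [exists w, [exists w',
  [&& adj v w, adj v w', w != w', adj x (h v w) & adj x (h v w')]]].

Lemma near_branchP v : near_branch v -> degree v = 3 /\ exists w w',
  [/\ adj v w, adj v w', w != w', adj x (h v w) & adj x (h v w')].
Proof.
by case/andP=> /eqP-> /existsP[w /existsP[w' /and5P[? ? ? ? ?]]]; split=> //; exists w, w'.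
Qed.

Lemma near_away v w0 : near_branch v -> adj v w0 -> exists w, [/\ adj v w, w != w0 & adj x (h v w)].
Proof.
move=> /near_branchP[_ [w [w' [vw vw' ww' xw xw']]]] vw0.
have [e|ne] := eqVneq w w0; last by exists w.
by exists w'; split=> //; rewrite -e eq_sym.
Qed.

(** Each of [p] and [q] starts an arm pointing away from [v] whose first flag [x] sees. The third
    branch of a theta from [x] to [a] uses the remaining arm at [v]. *)
Lemma near_not_between v p q w w' : near_branch v -> near_branch p -> near_branch q ->
  adj v w -> adj v w' -> w != w' -> p \in arm v w -> q \in arm v w' -> False.
Proof.
move=> nv np nq vw vw' ww' pw qw'.
have toward p0 w0 : near_branch p0 -> adj v w0 -> p0 \in arm v w0 ->
    exists u, [/\ adj p0 u, v \notin arm p0 u & adj x (h p0 u)] /\ arm p0 u \subset arm v w0.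
  move=> np0 vw0 p0A.
  have vp0 : v != p0 by apply: contraTneq p0A => <-; apply: arm_root.
  have [y p0y vA] := arm_cover connC vp0; have [u [p0u uy xu]] := near_away np0 p0y.
  have vu : v \notin arm p0 u.
    by apply: contra uy => vu; apply/eqP; apply: (arm_unique acyC p0u p0y vu vA).
  by exists u; split=> //; apply: arm_sub.
have [u1 [[pu1 vu1 xu1] sub1]] := toward p w np vw pw.
have [u3 [[qu3 vu3 xu3] sub3]] := toward q w' nq vw' qw'.
have vp : v != p by apply: contraTneq pw => <-; apply: arm_root.
have vq : v != q by apply: contraTneq qw' => <-; apply: arm_root.
have disj z : z \in arm v w -> z \notin arm v w'.
  move=> zw; apply: contra ww' => zw'; apply/eqP; exact: (arm_unique acyC vw vw' zw zw').
have [dv [y [y' [vy vy' yy' xy xy']]]] := near_branchP nv.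
have [w2 [vw2 w2w w2w']] : exists w2, [/\ adj v w2, w2 != w & w2 != w'].
  have : #|nbhd v :\ w :\ w'| == 1.
    have := dv; rewrite /degree (cardsD1 w) inE vw (cardsD1 w') !inE eq_sym ww' vw' /=.
    by nlia.
  by case/cards1P=> w2 e; have := set11 w2; rewrite -e !inE => /and3P[? ? ?]; exists w2.
have all3 z : adj v z -> [|| z == w, z == w' | z == w2].
  have e : nbhd v = [set w; w'; w2].
    apply/esym/eqP; rewrite eqEcard; apply/andP; split.
      by apply/subsetP=> z'; rewrite !inE => /orP[/orP[]|]/eqP->.
    rewrite -/(degree v) dv -setUA cardsU1 cards2 !inE negb_or ww' eq_sym w2w.
    by rewrite eq_sym w2w'.
  by move=> vz; have : z \in nbhd v; [rewrite inE | rewrite e !inE -orbA].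
have xa' : ~~ adj x a by rewrite adj_sym.
(* If [x] misses [h v w2], the two triangle vertices it sees are [h v w] and [h v w'], and the
   branch goes over [h v w]. *)
have via2 : via (h v w |: (h v w2 |: flags v w2)) x a.
  have [xw2|nxw2] := boolP (adj x (h v w2)).
    have [n [m [nQ xn nm ma]]] := flags_via vw2 xw2.
    exists n, m; split=> //; first by rewrite setU1r.
    by apply: linkedS nm; apply: subsetUr.
  have xw : adj x (h v w).
    case/or3P: (all3 y vy) => /eqP ey; [by rewrite -ey | | by rewrite -ey xy in nxw2].
    case/or3P: (all3 y' vy') => /eqP ey'; first by rewrite -ey'.
      by rewrite ey ey' eqxx in yy'.
    by rewrite -ey' xy' in nxw2.
  have [|n [m [nQ xn nm ma]]] := @flags_via v w2 (h v w) vw2.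
    by rewrite h_adj // eqxx eq_sym w2w.
  exists (h v w), m; split=> //; first exact: setU11.
  apply: (@linked_trans _ _ n); last by apply: linkedS nm; apply: subsetUr.
  by apply: linked1; [exact: setU11 | exact: setU1r |].
have far z : z \in arm v w \/ z \in arm v w' -> z \notin arm v w2.
  case=> zA; apply/negP=> z2.
    by move: w2w; rewrite (arm_unique acyC vw2 vw z2 zA) eqxx.
  by move: w2w'; rewrite (arm_unique acyC vw2 vw' z2 zA) eqxx.
apply: (theta_via free xa xa' (flags_via pu1 xu1) (flags_via qu3 xu3) via2).
- apply: flags_apart2 => //.
  + by apply: contraTneq pw => ->; apply: contraL qw' => /disj.
  + by apply: contraL pw => /(subsetP sub3) pw'; apply/negP=> /disj; rewrite pw'.
  + by apply: contraL qw' => /(subsetP sub1)/disj.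
- apply: apartUr; first exact: flags_apart.
  by apply: flags_apart2 => //; [rewrite eq_sym | apply: far; left].
apply: apartUr; first exact: flags_apart.
by apply: flags_apart2 => //; [rewrite eq_sym | apply: far; right].
Qed.

(** Of three such vertices none lies between the other two, so each has an arm avoiding both others
    whose first flag [x] sees; these are the branches of a theta. *)
Lemma card_near : #|[set v | near_branch v]| <= 2.
Proof.
rewrite leqNgt; apply/negP=> /card_gt2P[v1 [v2 [v3 [[]]]]].
rewrite !inE => n1 n2 n3 [v12 v23 v31].
have out v p q : near_branch v -> near_branch p -> near_branch q -> p != v -> q != v ->
    exists w, [/\ adj v w, p \notin arm v w, q \notin arm v w & adj x (h v w)].
  move=> nv np nq pv qv; have [w vw pw] := arm_cover connC pv.
  have [w' vw' qw'] := arm_cover connC qv.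
  have [e|ww'] := eqVneq w w'; last by have := near_not_between nv np nq vw vw' ww' pw qw'.
  subst w'; have [u [vu uw xu]] := near_away nv vw; exists u; split=> //.
    by apply: contra uw => pu; apply/eqP; apply: (arm_unique acyC vu vw pu pw).
  by apply: contra uw => qu; apply/eqP; apply: (arm_unique acyC vu vw qu qw').
have v21 : v2 != v1 by [rewrite eq_sym]; have v32 : v3 != v2 by rewrite eq_sym.
have v13 : v1 != v3 by rewrite eq_sym.
have [w1 [vw1 a12 a13 x1]] := out v1 v2 v3 n1 n2 n3 v21 v31.
have [w2 [vw2 a21 a23 x2]] := out v2 v1 v3 n2 n1 n3 v12 v32.
have [w3 [vw3 a31 a32 x3]] := out v3 v1 v2 n3 n1 n2 v13 v23.
have xa' : ~~ adj x a by rewrite adj_sym.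
by apply: (theta_via free xa xa' (flags_via vw1 x1) (flags_via vw2 x2) (flags_via vw3 x3));
  apply: flags_apart2.
Qed.

End Flags.

(** * Combining separations along the tree *)

Section Cutting.
Variables (G C : sgraph) (a : G) (h : C -> C -> G) (t : nat) (x : G).
Hypotheses (connC : forall x y : C, connect adj x y) (acyC : acyclic C).
Hypothesis h_inj : forall u w u' w', adj u w -> adj u' w' -> h u w = h u' w' -> u = u' /\ w = w'.
Hypothesis h_adj : forall u w u' w', adj u w -> adj u' w' ->
  adj (h u w) (h u' w') = (u == u') && (w != w') || (u == w') && (w == u').
Hypothesis h_a : forall u w, adj u w -> h u w != a.
Hypothesis h_leaf : forall u w, adj u w -> adj a (h u w) = (degree u == 1).
Hypothesis nbhd_a : forall n, adj a n -> exists u w, adj u w /\ n = h u w.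
Hypothesis pendant : forall n u v : G,
  adj a n -> adj n u -> adj n v -> u != a -> v != a -> u = v.
Hypothesis free : theta_prism_free G.
Hypothesis small_cliques : cliques_below t [set: G].
Hypotheses (xa : x != a) (nax : ~~ adj a x).
Hypothesis deg3 : forall v : C, degree v <= 3.
Implicit Types (u v w p q : C) (Z : {set C}) (S : {set G}).

(** The bound of [local_cut] plus one, so that the one-vertex cut at a leaf fits as well. *)
Let M := (3 * t + 2 * (t * t)).+1.
Let near := near_branch h x.

(** The leaves of the tree in [Z] stand for neighbours of [a]. Paths through [a] are excluded, since
    they would connect all of these. *)
Definition cuts S Z := [/\ a \notin S, x \notin S & forall u u', u \in Z -> degree u = 1 ->
  adj u u' -> ~~ linked (~: (a |: S)) x (h u u')].

Lemma cutsU S S' Z Z' : cuts S Z -> cuts S' Z' -> cuts (S :|: S') (Z :|: Z').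
Proof.
move=> [aS xS c] [aS' xS' c']; split; rewrite ?in_setU ?negb_or ?aS ?xS //.
move=> u u'; rewrite in_setU => /orP uZ du uu'; case: uZ => uZ.
  by apply: contra (c u u' uZ du uu'); apply: linkedS; rewrite setCS setUS ?subsetUl.
by apply: contra (c' u u' uZ du uu'); apply: linkedS; rewrite setCS setUS ?subsetUr.
Qed.

Lemma cutsS S Z Z' : Z' \subset Z -> cuts S Z -> cuts S Z'.
Proof. by move=> /subsetP ZZ' [aS xS c]; split=> // u u' /ZZ'; apply: c. Qed.

Lemma nbr_enum v : degree v = 3 -> exists w : 'I_3 -> C,
  injective w /\ forall u, adj v u <-> exists i, u = w i.
Proof.
move=> dv; have e : 3 = #|nbhd v| by [].
exists (fun i => enum_val (cast_ord e i)); split.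
  by move=> i j /enum_val_inj/cast_ord_inj.
move=> u; split=> [vu|[i ->]]; last first.
  by have := enum_valP (cast_ord e i); rewrite inE.
have uN : u \in nbhd v by rewrite inE.
exists (cast_ord (esym e) (enum_rank_in uN u)).
by rewrite cast_ordKV enum_rankK_in.
Qed.

(** The part returned by [local_cut] is the one arm whose leaves may remain reachable. *)
Lemma branch_cut v : degree v = 3 -> ~~ near v -> exists w S,
  [/\ adj v w, #|S| <= M & cuts S (~: arm v w)].
Proof.
move=> dv nv; have [w [winj wP]] := nbr_enum dv.
have vw i : adj v (w i) by apply/wP; exists i.
have T := branch_tripod connC acyC h_inj h_adj h_a h_leaf nbhd_a dv winj wP.
have [//||S [i [aS xS Scard Scut]]] :=
  @local_cut G a t free pendant small_cliques _ _ (fun i => h v (w i)) x T _ xa nax.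
- by move=> i; rewrite set11.
- move=> i j ij; apply: contra nv => /andP[xi xj]; rewrite /near /near_branch dv /=.
  apply/existsP; exists (w i); apply/existsP; exists (w j).
  by rewrite !vw xi xj !andbT; apply: contra ij => /eqP /winj ->.
exists (w i), S; split=> //; first exact: leqW.
split=> // u u'; rewrite in_setC => uA du uu'; apply: contra uA => xu.
have := Scut (h u u'); rewrite h_leaf // du => /(_ isT xu).
case/setU1P=> [e|/flagsP[p [p' [pA pp' e]]]]; last by have [-> _] := h_inj uu' pp' e.
by have [e1 _] := h_inj uu' (vw i) e; move: dv; rewrite -e1 du.
Qed.

(* A cut at a branch vertex either points back to [v], and cuts off the arm, or points
   into a smaller arm, and any cut of that arm then completes it to a full cut. Only near
   branch vertices add up, and there are at most two of them. *)
Lemma arm_cut v w : adj v w ->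
  (exists2 S, cuts S setT & #|S| <= 4 * M) \/
  (exists2 S, cuts S (arm v w) & #|S| <= M * #|[set u in arm v w | near u]|.+1).
Proof.
have [m] := ubnP #|arm v w|; elim: m v w => // m IH v w lem vw.
have IHw w' : adj w w' -> w' != v ->
  (exists2 S, cuts S setT & #|S| <= 4 * M) \/
  (exists2 S, cuts S (arm w w') & #|S| <= M * #|[set u in arm w w' | near u]|.+1).
  by move=> ww' w'v; apply: IH => //; apply: leq_trans (card_arm acyC vw ww' w'v) _.
have vN : v \in nbhd w by rewrite inE adj_sym.
have dN : degree w = #|nbhd w :\ v|.+1 by rewrite /degree (cardsD1 v) vN.
have near_le w' : adj w w' -> w' != v ->
    #|[set u in arm w w' | near u]| <= #|[set u in arm v w | near u]|.
  move=> ww' w'v; apply: subset_leq_card; apply/subsetP=> u; rewrite !inE.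
  case/andP=> uA ->; rewrite andbT; have uA' : u \in arm w w' by rewrite inE.
  by have := subsetP (arm_trans acyC vw ww' w'v) u uA'; rewrite inE.
have card_c : #|nbhd w :\ v| = 0 \/ (#|nbhd w :\ v| = 1 \/ #|nbhd w :\ v| = 2).
  by have := deg3 w; rewrite dN; nlia.
case: card_c => [/eqP c0|[/eqP c1|c2]].
(* The arm is a single leaf, and its flag is the cut; it differs from [x], which does not see
   [a]. *)
- right; have dw : degree w = 1 by rewrite dN (eqP c0).
  have wv : adj w v by rewrite adj_sym.
  have uniq_nbr u : adj w u -> u = v.
    move=> wu; apply/eqP/negPn/negP=> uv; move: c0; rewrite cards_eq0 => /eqP/setP/(_ u).
    by rewrite !inE uv wu.
  exists [set h w v]; last by rewrite cards1; nlia.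
  have ah : adj a (h w v) by rewrite h_leaf // dw.
  have hx : x != h w v by apply: contraNneq nax => ->.
  split; rewrite ?in_set1 //; first by rewrite eq_sym h_a.
  move=> u u' uA du uu'; have uw : u = w.
    apply/eqP/negPn/negP=> uw; have [w' [ww' w'v _]] := arm_step uA uw.
    by rewrite (uniq_nbr w' ww') eqxx in w'v.
  subst u; rewrite (uniq_nbr u' uu').
  apply/negP=> xh; have := linked_mem xh.
  rewrite !inE eqxx orbT negb_or xa hx /= => /(_ isT); done.
- case/cards1P: c1 => w' e; have := set11 w'; rewrite -e !inE => /andP[w'v ww'].
  case: (IHw w' ww' w'v) => [full|[S Sc Sm]]; [by left | right].
  exists S; last by apply: leq_trans Sm _; rewrite leq_mul2l ltnS near_le ?orbT.
  have [aS xS Scut] := Sc; split=> // u u' uA du uu'.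
  have [uw|uw] := eqVneq u w.
    by have /eqP := dN; rewrite -uw du uw e cards1.
  have [w2 [ww2 w2v uA2]] := arm_step uA uw.
  have : w2 \in [set w'] by rewrite -e !inE w2v.
  by rewrite in_set1 => /eqP e2; apply: Scut => //; rewrite -e2.
have dw : degree w = 3 by rewrite dN c2.
have [nw|nw] := boolP (near w); last first.
  have [d [S [wd Sm Sc]]] := branch_cut dw nw.
  (* If the open arm points back to [v], the cut handles [arm v w] alone. Otherwise a cut of
     [arm w d] completes it to all leaves, at cost [M + 3 * M]. *)
  have [dv|dv] := eqVneq d v.
    right; exists S; last by apply: leq_trans Sm _; nlia.
    apply: cutsS Sc; apply/subsetP=> u uA; rewrite in_setC dv.
    have wv : adj w v by rewrite adj_sym.
    have [->|uw] := eqVneq u w; first exact: arm_root.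
    have [w' [ww' w'v uA']] := arm_step uA uw.
    by apply: contra w'v => uv; apply/eqP; apply: (arm_unique acyC ww' wv uA' uv).
  left; case: (IHw d wd dv) => [//|[S' Sc' Sm']].
  exists (S :|: S'); first by have := cutsU Sc Sc'; rewrite [~: _ :|: _]setUC setUCr.
  have le2 : #|[set u in arm w d | near u]| <= 2.
    apply: leq_trans (card_near connC acyC h_inj h_adj h_leaf free xa nax).
    by apply: subset_leq_card; apply/subsetP=> u; rewrite !inE => /andP[].
  apply: leq_trans (leq_card_setU _ _) _.
  have : M * #|[set u in arm w d | near u]|.+1 <= M * 3 by rewrite leq_mul2l ltnS le2 orbT.
  by nlia.
have /cards2P[w1 [w2 [w12 e]]] : #|nbhd w :\ v| == 2 by rewrite c2.
have : w1 \in [set w1; w2] by rewrite !inE eqxx.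
have : w2 \in [set w1; w2] by rewrite !inE eqxx orbT.
rewrite -e !inE => /andP[w2v ww2] /andP[w1v ww1].
case: (IHw w1 ww1 w1v) => [full|[S1 Sc1 Sm1]]; first by left.
case: (IHw w2 ww2 w2v) => [full|[S2 Sc2 Sm2]]; first by left.
right; exists (S1 :|: S2).
  have [aS xS Scut] := cutsU Sc1 Sc2; split=> // u u' uA du uu'.
  have [uw|uw] := eqVneq u w; first by rewrite -uw du in dw.
  have [w' [ww' w'v uA']] := arm_step uA uw.
  have w'N : w' \in [set w1; w2] by rewrite -e !inE w'v.
  by apply: Scut => //; rewrite in_setU; case/set2P: w'N => <-; rewrite uA' ?orbT.
set N1 := [set u in arm w w1 | near u] in Sm1; set N2 := [set u in arm w w2 | near u] in Sm2.
(* The vertex [w] is itself near and pays for the second extra [M]: the two bounds add up to [M]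
   times [#|N1| + #|N2| + 2]. *)
have sub : w |: (N1 :|: N2) \subset [set u in arm v w | near u].
  have s1 := subsetP (arm_trans acyC vw ww1 w1v); have s2 := subsetP (arm_trans acyC vw ww2 w2v).
  apply/subsetP=> u; rewrite in_setU1 in_setU => /predU1P[->|/orP[]]; rewrite !in_set.
  - by rewrite nw linked_refl.
  - by case/andP=> uA ->; have := s1 u; rewrite !in_set uA andbT; apply.
  - by case/andP=> uA ->; have := s2 u; rewrite !in_set uA andbT; apply.
have dis : N1 :&: N2 = set0.
  apply/setP=> u; rewrite !in_set; apply/negbTE/negP=> /andP[/andP[u1 _] /andP[u2 _]].
  by case/eqP: w12; apply: (arm_unique acyC ww1 ww2 (u := u)); rewrite inE.
have wN : w \notin N1 :|: N2.
  apply/negP=> /setUP[]; rewrite in_set => /andP[wA _].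
    by case/negP: (arm_root ww1).
  by case/negP: (arm_root ww2).
have := subset_leq_card sub; rewrite cardsU1 wN cardsU dis cards0 subn0 => cN.
apply: leq_trans (leq_card_setU _ _) _; apply: leq_trans (leq_add Sm1 Sm2) _.
by rewrite -mulnDr leq_mul2l; apply/orP; right; nlia.
Qed.

(** Three arms at any branch vertex, each at cost at most [3 * M] as at most two branch vertices are
    near, unless a full cut of size [4 * M] appears earlier. *)
Lemma total_cut v : degree v = 3 -> exists2 S, cuts S setT & #|S| <= 9 * M.
Proof.
move=> dv; have [w [winj wP]] := nbr_enum dv.
have vw i : adj v (w i) by apply/wP; exists i.
have le i : (exists2 S, cuts S setT & #|S| <= 4 * M) \/
    exists2 S, cuts S (arm v (w i)) & #|S| <= 3 * M.
  case: (arm_cut (vw i)) => [|[S Sc Sm]]; [by left | right; exists S => //].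
  apply: leq_trans Sm _; rewrite mulnC leq_mul2r ltnS; apply/orP; right.
  apply: leq_trans (card_near connC acyC h_inj h_adj h_leaf free xa nax).
  by apply: subset_leq_card; apply/subsetP=> u; rewrite !inE => /andP[].
have done_ : (exists2 S, cuts S setT & #|S| <= 4 * M) ->
    exists2 S, cuts S setT & #|S| <= 9 * M.
  by case=> S Sc Sm; exists S => //; apply: leq_trans Sm _; rewrite leq_mul2r orbT.
case: (le ord0) => [/done_ //|[S0 c0 m0]].
have [i1 [i2 [_ _ _ tri]]] := other_indices ord0.
case: (le i1) => [/done_ //|[S1 c1 m1]]; case: (le i2) => [/done_ //|[S2 c2 m2]].
exists (S0 :|: (S1 :|: S2)).
  have [aS xS Sc] := cutsU c0 (cutsU c1 c2); split=> // u u' _ du uu'; apply: Sc => //.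
  have uv : u != v by apply: contra_eq_neq du => ->; rewrite dv.
  have [y vy uA] := arm_cover connC uv; have [i yi] := (wP y).1 vy.
  by rewrite !in_setU; move: uA; rewrite yi; case: (tri i) => [->|[->|->]] ->; rewrite ?orbT.
apply: leq_trans (leq_card_setU _ _) _.
by have := leq_of_leqif (leq_card_setU S1 S2); nlia.
Qed.

(** The side of [x] is all it reaches outside [a] and [S]; an edge from [a] into that side would end
    at the flag of a leaf. *)
Lemma cuts_separates S : cuts S setT -> separates S a x.
Proof.
move=> [aS xS Sc]; split.
  by apply/subsetP=> z zS; rewrite !inE negb_or; apply/andP; split; apply: contraTneq zS => ->.
pose R := [set z | linked (~: (a |: S)) x z].
have xU : x \in ~: (a |: S) by rewrite !inE negb_or xa.
have RU z : z \in R -> z \in ~: (a |: S) by rewrite inE => /linked_mem; apply.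
have RS z : z \in R -> z \notin S by move/RU; rewrite !inE negb_or => /andP[].
exists (~: (S :|: R)), R; split.
- split.
  + by rewrite -setUA setUC setUCr.
  + by rewrite disjoints_subset setCS subsetUl.
  + by rewrite disjoints_subset setCS subsetUr.
  + rewrite disjoints_subset; apply/subsetP=> z zS; rewrite in_setC.
    by apply: contraL zS => /RS.
- rewrite !in_setC in_setU negb_or aS; apply/negP=> /RU.
  by rewrite !inE eqxx.
- by rewrite inE linked_refl.
move=> u v; rewrite in_setC in_setU negb_or => /andP[uS uR] vR; apply/negP=> uv.
have [ua|ua] := eqVneq u a.
  subst u; have [p [p' [pp' vE]]] := nbhd_a uv.
  have := uv; rewrite vE h_leaf // => /eqP dp.
  by have /negP := Sc p p' (in_setT _) dp pp'; apply; rewrite -vE; rewrite inE in vR.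
case/negP: uR; move: (vR); rewrite !inE => xv; apply: linked_trans xv _.
by apply: linked1; [exact: RU | rewrite !inE negb_or ua | rewrite adj_sym].
Qed.

End Cutting.

(** * Flags from the line graph of the subdivision *)

Section SeedFlags.
Variables (G C : sgraph) (a : G) (S : {set G}).
Hypothesis iso : isomorphic (induced S) (line_graph (subdiv1 C)).

(* The vertex [z] of the seed is the edge of the subdivision joining [u] to the
   subdivision vertex of the edge [uw]. *)
Lemma seed_flags : exists h : C -> C -> G,
  [/\ forall u w u' w', adj u w -> adj u' w' -> h u w = h u' w' -> u = u' /\ w = w',
      forall u w u' w', adj u w -> adj u' w' ->
        adj (h u w) (h u' w') = (u == u') && (w != w') || (u == w') && (w == u'),
      forall u w, adj u w -> h u w \in S &
      forall z, z \in S -> exists u w, adj u w /\ z = h u w].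
Proof.
have [f [[g fK gK] f_adj]] := iso.
pose flag (u w : C) (z : induced S) := exists e : edge C,
  val e = [set u; w] /\ val (f z) = [set inl u; inr e].
have flag_ex (p : C * C) : exists z : G, adj p.1 p.2 ->
    exists2 z' : induced S, val z' = z & flag p.1 p.2 z'.
  (* For a nonadjacent pair the value is the dummy [a]. *)
  case: p => u w /=; have [uw|nuw] := boolP (adj u w); last by exists a.
  have uwE : [set u; w] \in edges C by apply/imsetP; exists (u, w); rewrite ?inE.
  pose e : edge C := exist _ [set u; w] uwE.
  have ueE : [set inl u; inr e] \in edges (subdiv1 C).
    apply/imsetP; exists (inl u : subdiv1 C, inr e : subdiv1 C) => //.
    by rewrite inE /= !inE eqxx.
  pose fl : edge (subdiv1 C) := exist _ [set inl u; inr e] ueE.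
  exists (val (g fl)) => _; exists (g fl) => //.
  by exists e; split=> //; rewrite gK.
have [h0 h0P] := fin_all_exists flag_ex.
pose h u w := h0 (u, w).
have hP u w : adj u w -> exists2 z : induced S, val z = h u w & flag u w z.
  by move=> uw; apply: (h0P (u, w)).
have pair_eq (u w u' w' : C) : adj u w -> [set u; w] = [set u'; w'] ->
    u = u' /\ w = w' \/ u = w' /\ w = u'.
  move=> uw e; have un := adj_neq uw.
  have : u \in [set u'; w'] by rewrite -e set21.
  have : w \in [set u'; w'] by rewrite -e set22.
  case/set2P=> ew /set2P[] eu; first by rewrite eu ew eqxx in un.
  - by right.
  - by left.
  by rewrite eu ew eqxx in un.
have flag_eq u w u' w' (z z' : induced S) : adj u w -> adj u' w' -> flag u w z -> flag u' w' z' ->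
    z = z' -> u = u' /\ w = w'.
  move=> uw uw' [e [ew ez]] [e' [ew' ez']] zz'; rewrite zz' ez' in ez.
  have : inl u \in [set inl u'; inr e'] by rewrite ez set21.
  case/set2P=> [[uu']|//]; split=> //.
  have : inr e \in [set inl u'; inr e'] by rewrite ez set22.
  case/set2P=> [//|[ee']]; move: ew; rewrite ee' ew' => /esym/(pair_eq _ _ _ _ uw).
  by case=> [[_ ->]//|[e1 e2]]; rewrite e1 e2 in uu' *; rewrite -uu'.
exists h; split.
- move=> u w u' w' uw uw' hh; have [z zh zf] := hP u w uw; have [z' zh' zf'] := hP u' w' uw'.
  by apply: (flag_eq u w u' w' z z') => //; apply: val_inj; rewrite zh zh'.
- move=> u w u' w' uw uw'; have [z zh zf] := hP u w uw; have [z' zh' zf'] := hP u' w' uw'.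
  rewrite -zh -zh' -[adj (val z) (val z')]/(adj z z') -f_adj.
  have -> : adj (f z) (f z') = (f z != f z') && (val (f z) :&: val (f z') != set0) by [].
  rewrite (can_eq fK); move: (zf) (zf') => [e [ew ez]] [e' [ew' ez']]; rewrite ez ez'.
  (* Two edges of the subdivision share an end in two ways: at an original vertex, which gives the
     cliques, or at a subdivision vertex, which matches the two flags of an edge. *)
  have meet : ([set inl u; inr e] :&: [set inl u'; inr e'] != set0 :> {set C + edge C}) =
      (u == u') || (e == e').
    apply/set0Pn/orP=> [[y /setIP[/set2P[]-> /set2P[]] // [->]]|[]/eqP->]; rewrite ?eqxx;
      [by left | by right | |].
    + by exists (inl u'); rewrite !inE eqxx.
    + by exists (inr e'); rewrite !inE eqxx !orbT.
  rewrite meet.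
  have zz : (z == z') = (u == u') && (w == w').
    apply/eqP/andP=> [zz'|[/eqP uu' /eqP ww']].
      by have [-> ->] := flag_eq u w u' w' z z' uw uw' zf zf' zz'.
    by apply: val_inj; rewrite zh zh' uu' ww'.
  have ee : (e == e') = (u == u') && (w == w') || (u == w') && (w == u').
    rewrite -(inj_eq val_inj) ew ew'; apply/eqP/orP=> [/(pair_eq _ _ _ _ uw)|].
      by case=> -[-> ->]; rewrite !eqxx; [left | right].
    by case=> /andP[/eqP-> /eqP->] //; rewrite setUC.
  rewrite zz ee; have [uu'|uu'] /= := eqVneq u u'; last by rewrite /=.
  have un := adj_neq uw'; subst u'; rewrite (negPf un) /= orbF; by case: eqP.
- by move=> u w uw; have [z <- _] := hP u w uw; apply: valP.
move=> z zS; pose z' : induced S := exist _ z zS.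
have [[p q] /= pq pqE] := imsetP (valP (f z')); rewrite inE /= in pq.
change (val (f z') = [set p; q]) in pqE.
suff [u [w [uw uwf]]] : exists u w, adj u w /\ flag u w z'.
  exists u, w; split=> //; have [z2 z2h [e2 [e2v e2f]]] := hP u w uw.
  rewrite -z2h -[z]/(val z'); congr val; apply: (can_inj fK); apply: val_inj.
  have [e [ev ef]] := uwf; rewrite ef e2f.
  by have -> : e = e2 by apply: val_inj; rewrite ev e2v.
have build (u : C) (e : edge C) : u \in val e -> val (f z') = [set inl u; inr e] ->
    exists u w, adj u w /\ flag u w z'.
  move=> ue ze; have [[r s] /= rs rsE] := imsetP (valP e); rewrite inE /= in rs.
  change (val e = [set r; s]) in rsE.
  move: ue; rewrite rsE => /set2P[] eu.
    by exists r, s; split=> //; exists e; rewrite ze rsE eu.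
  by exists s, r; split; [rewrite adj_sym | exists e; rewrite ze rsE eu setUC].
case: p q pq pqE => [u|e] [u'|e'] //= ue ze; first exact: build ue ze.
by apply: (build _ _ ue); rewrite setUC; exact: ze.
Qed.

End SeedFlags.

(** All neighbours of [n] are within distance two of [a] and so lie in [U]; three different ones
    contradict degree two there. *)
Lemma trapped_pendant (G : sgraph) (a : G) (U : {set G}) (n u v : G) : trapped a U ->
  adj a n -> adj n u -> adj n v -> u != a -> v != a -> u = v.
Proof.
move=> [inU deg2] an nu nv ua va; apply/eqP/negPn/negP=> uv.
have inU2 y : adj n y -> y \in U.
  by move=> ny; apply: inU; exists [:: n; y]; rewrite /= an ny.
have nU : n \in U by apply: inU; exists [:: n]; rewrite /= an.
have na : adj n a by rewrite adj_sym.
pose lift (y : G) (yU : y \in U) : induced U := exist _ y yU.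
pose a' := lift a (inU2 a na); pose u' := lift u (inU2 u nu); pose v' := lift v (inU2 v nv).
have sub : [set a'; u'; v'] \subset nbhd (lift n nU).
  by apply/subsetP=> z; rewrite !inE => /orP[/orP[]|]/eqP->.
have := subset_leq_card sub; rewrite -/(degree _) (deg2 (lift n nU)) //.
rewrite -setUA cardsU1 cards2 !inE negb_or -!(inj_eq val_inj) /=.
by rewrite ![a == _]eq_sym ua va uv.
Qed.

(** In the seed [h u w] sees [h w u] and the other flags at [u], and these do not see [h w u]. So it
    is simplicial exactly when there are no other flags at [u]. *)
Lemma seed_leaf (G C : sgraph) (a : G) (S : {set G}) (h : C -> C -> G) :
  nbhd a = [set val z | z in simplicial (induced S)] ->
  (forall u w u' w', adj u w -> adj u' w' -> h u w = h u' w' -> u = u' /\ w = w') ->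
  (forall u w u' w', adj u w -> adj u' w' ->
     adj (h u w) (h u' w') = (u == u') && (w != w') || (u == w') && (w == u')) ->
  (forall u w, adj u w -> h u w \in S) ->
  (forall z, z \in S -> exists u w, adj u w /\ z = h u w) ->
  forall u w, adj u w -> adj a (h u w) = (degree u == 1).
Proof.
move=> nba h_inj h_adj hS Sh u w uw; have wu : adj w u by rewrite adj_sym.
pose lift p q (pq : adj p q) : induced S := exist _ (h p q) (hS p q pq).
have -> : adj a (h u w) = (h u w \in nbhd a) by rewrite inE.
have -> : (h u w \in nbhd a) = (lift u w uw \in simplicial (induced S)).
  rewrite nba; apply/imsetP/idP=> [[z zs e]|zs]; last by exists (lift u w uw).
  by rewrite (_ : lift u w uw = z) //; apply: val_inj.
rewrite inE; apply/cliqueP/eqP=> [cl|du].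
  rewrite /degree (cardsD1 w) inE uw [X in 1 + X](_ : _ = 0) //.
  apply/eqP; rewrite cards_eq0; apply/eqP/setP=> w'; rewrite !inE.
  apply/negbTE/negP=> /andP[w'w uw'].
  have := cl (lift u w' uw') (lift w u wu); rewrite !inE /= /induced_adj /= !h_adj //.
  rewrite !eqxx eq_sym w'w orbT -(inj_eq val_inj) /= => /(_ isT isT).
  have un := adj_neq uw.
  have ne : h u w' != h w u by apply: contraNneq un => /(h_inj _ _ _ _ uw' wu)[-> _].
  by rewrite ne (negPf un) (negPf w'w) ?andbF => /(_ isT).
move=> z z'; rewrite !inE => zn zn' zz'; case/negP: zz'; apply/eqP; apply: val_inj.
have only (y : induced S) : adj (h u w) (val y) -> val y = h w u.
  have [p [q [pq ye]]] := Sh _ (valP y); rewrite ye h_adj //.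
  case/orP=> [/andP[/eqP up wq]|/andP[/eqP up /eqP wq]].
    have /eqP := du; rewrite /degree (cardsD1 w) (cardsD1 q) !inE uw [q == w]eq_sym wq /=.
    by have -> : adj u q by rewrite up.
  by rewrite up wq.
by rewrite (only z zn) (only z' zn').
Qed.

Theorem theorem6p2 :
  forall t : nat, 1 <= t ->
  exists s : nat, 1 <= s /\
  forall (G : sgraph) (a : G),
    theta_prism_free G ->
    ~ (exists K : {set G}, clique K /\ #|K| = t) ->
    (exists H : {set G}, is_seed a H) ->
    forall x : G, x \notin closed_nbhd a ->
    exists S : {set G},
      [/\ S \subset ~: [set a; x], #|S| < s & separates S a x].
Proof.
(* The bound of [total_cut], plus one for the strict inequality. *)
move=> t _; exists (9 * (3 * t + 2 * (t * t)).+1).+1; split=> //.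
move=> G a free noclique [H [aH [C [[[[[v0 _] connC] acyC] maxC _] iso]] nba trap]] x.
rewrite !inE negb_or => /andP[xa nax].
have [h [h_inj h_adj hH Hh]] := seed_flags a iso.
have h_a u w : adj u w -> h u w != a by move=> /hH; apply: contraTneq => ->.
have h_leaf := seed_leaf nba h_inj h_adj hH Hh.
have nbhd_a n : adj a n -> exists u w, adj u w /\ n = h u w.
  move=> an; have : n \in nbhd a by rewrite inE.
  by rewrite nba => /imsetP[z _ ->]; apply: Hh; apply: valP.
have pendant n u v := @trapped_pendant G a (a |: H) n u v trap.
have deg3 (v : C) : degree v <= 3 by rewrite -maxC; apply: leq_bigmax.
(* The maximum degree is exactly three and is attained, so there is a branch vertex to start
   from. *)
have [v dv] : exists v : C, degree v = 3.
  have C_gt0 : 0 < #|C| by apply/card_gt0P; exists v0.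
  have [v vE] := eq_bigmax (@degree C) C_gt0.
  by exists v; rewrite -maxC -vE.
have [S Sc Sm] := total_cut connC acyC h_inj h_adj h_a h_leaf nbhd_a pendant free
  (cliques_belowT noclique) xa nax deg3 dv.
have Ssep := cuts_separates h_leaf nbhd_a xa Sc.
by exists S; split=> //; case: Ssep.
Qed.
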